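(* Let $v,w$ be weights on $\mathbb{R}$. The family of operators $M_v^{1/2}T_\sigma M_w^{1/2}$, where $\sigma=(\sigma_I)_{I\in\mathcal{D}}$ ranges over all sequences of signs $\pm1$, is uniformly bounded in $L^2(\mathbb{R})$ (that is, $\sup_\sigma\|M_v^{1/2}T_\sigma M_w^{1/2}\|_{L^2\to L^2}<\infty$) if and only if there is a constant $C<\infty$ such that the following four assertions hold simultaneously: (1) for every $J\in\mathcal{D}$, $\langle v\rangle_J\langle w\rangle_J\le C$; (2) for every $J\in\mathcal{D}$, $\displaystyle\frac1{|J|}\sum_{I\in\mathcal{D},\,I\subseteq J}|\langle v\rangle_{I_-}-\langle v\rangle_{I_+}|^2\langle w\rangle_I|I|\le C\langle v\rangle_J$; (3) for every $J\in\mathcal{D}$, $\displaystyle\frac1{|J|}\sum_{I\in\mathcal{D},\,I\subseteq J}|\langle w\rangle_{I_-}-\langle w\rangle_{I_+}|^2\langle v\rangle_I|I|\le C\langle w\rangle_J$; (4) the operator $T_0$ is bounded from $L^2(w^{-1})$ to $L^2(v)$, or, equivalently, the operator $M_v^{1/2}T_0M_w^{1/2}$ is bounded in $L^2(\mathbb{R})$.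
   Context: $\mathcal{D}$ is the set of dyadic intervals of $\mathbb{R}$; for $I\in\mathcal{D}$, $I_-$ and $I_+$ are its left and right halves, $|I|$ its length, $\chi_I$ its characteristic function, and $\langle f\rangle_I=\frac1{|I|}\int_I f\,dx$. A weight is a locally integrable function on $\mathbb{R}$ that is positive almost everywhere; for a positive function $\omega$, $L^2(\omega)$ has norm $(\int|f|^2\omega\,dx)^{1/2}$. The Haar function is $h_I=|I|^{-1/2}\chi_{I_-}-|I|^{-1/2}\chi_{I_+}$. For a sequence of signs $\sigma=(\sigma_I)_{I\in\mathcal{D}}$, $\sigma_I\in\{+1,-1\}$, $T_\sigma f=\sum_{I\in\mathcal{D}}\sigma_I (f,h_I)h_I$, where $(f,g)=\int_{\mathbb{R}} f g\,dx$. $M_v^{1/2}$ and $M_w^{1/2}$ are the operators of multiplication by $v^{1/2}$ and $w^{1/2}$. The operators $M_v^{1/2}T_\sigma M_w^{1/2}$ are initially defined on bounded compactly supported functions $f$ (for which $w^{1/2}f\in L^2(\mathbb{R})$), and the norm is the best constant in the $L^2$ bound on such functions. For $I\in\mathcal{D}$ put $$\alpha_I=\left|\frac{\langle v\rangle_{I_-}-\langle v\rangle_{I_+}}{\langle v\rangle_I}\right|\left|\frac{\langle w\rangle_{I_-}-\langle w\rangle_{I_+}}{\langle w\rangle_I}\right||I|,$$ and let $T_0f=\sum_{I\in\mathcal{D}}\frac1{|I|}\langle f\rangle_I\,\alpha_I\,\chi_I$, i.e. the integral operator with the nonnegative kernel $k(x,y)=\sum_{I\in\mathcal{D}}|I|^{-2}\chi_I(x)\chi_I(y)\alpha_I$.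 *)

(* Defs.v *)
From HB Require Import structures.
From mathcomp Require Import all_boot all_order all_algebra finmap.
From mathcomp Require Import all_classical all_reals all_analysis.
Set Implicit Arguments.
Unset Strict Implicit.
Unset Printing Implicit Defensive.
Import Order.TTheory GRing.Theory Num.Theory.
Import numFieldNormedType.Exports.
Local Open Scope classical_set_scope.
Local Open Scope ring_scope.

(* The pair (k, j) stands for the interval [j 2^k, (j + 1) 2^k[.  This coding is
   injective, so sums over dyadic intervals are sums over such pairs. *)
Notation dyadic := (int * int)%type.

Definition left_half (I : dyadic) : dyadic := (I.1 - 1, 2 * I.2).
Definition right_half (I : dyadic) : dyadic := (I.1 - 1, 2 * I.2 + 1).

Section Dyadic.
Context {R : realType}.
Local Notation mu := (@lebesgue_measure R).

Definition len (I : dyadic) : R := 2 ^ I.1.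

Definition dset (I : dyadic) : set R :=
  [set` `[I.2%:~R * 2 ^ I.1, (I.2 + 1)%:~R * 2 ^ I.1[].

Definition avg (f : R -> R) (I : dyadic) : R :=
  (len I)^-1 * \int[mu]_(x in dset I) f x.

Definition weight (w : R -> R) : Prop :=
  locally_integrable setT w /\ {ae mu, forall x, 0 < w x}.

Definition haar (I : dyadic) (x : R) : R :=
  (Num.sqrt (len I))^-1 * \1_(dset (left_half I)) x
  - (Num.sqrt (len I))^-1 * \1_(dset (right_half I)) x.

Definition inner (f g : R -> R) : R := \int[mu]_x (f x * g x).

Definition L2norm (f : R -> \bar R) : \bar R := 'N[mu]_(2%:E)[f].

Definition wL2norm (omega : R -> R) (f : R -> \bar R) : \bar R :=
  ((\int[mu]_x (`|f x| ^+ 2 * (omega x)%:E)) `^ 2^-1)%E.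

Definition L2 : set (R -> R) :=
  [set f : R -> R | measurable_fun setT f /\ (L2norm (EFin \o f) < +oo)%E].

Definition wL2 (omega : R -> R) : set (R -> R) :=
  [set f : R -> R | measurable_fun setT f /\ (wL2norm omega (EFin \o f) < +oo)%E].

Definition bounded_compactly_supported : set (R -> R) :=
  [set f : R -> R | [/\ measurable_fun setT f, exists M, forall x, `|f x| <= M &
    exists2 K, compact K & forall x, ~ K x -> f x = 0]].

(* Best constant C in N2 (T f) <= C N1 f for f in D; it is +oo if there is no
   such C. *)
Definition opnorm (D : set (R -> R)) (N1 N2 : (R -> \bar R) -> \bar R)
    (T : (R -> R) -> (R -> \bar R)) : \bar R :=
  ereal_inf [set C%:E | C in [set C : R | 0 <= C /\
    forall f, D f -> (N2 (T f) <= C%:E * N1 (EFin \o f))%E]].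

Definition signs : set (dyadic -> R) :=
  [set sigma | forall I, sigma I = 1 \/ sigma I = -1].

Definition haar_psum (sigma : dyadic -> R) (g : R -> R) (A : {fset dyadic})
    (x : R) : R :=
  \sum_(I <- A) sigma I * inner g (haar I) * haar I x.

(* F is the sum of the series defining T_sigma g, in the sense of unconditional
   convergence in L^2. *)
Definition haar_sum (sigma : dyadic -> R) (g F : R -> R) : Prop :=
  measurable_fun setT F /\
  forall eps : R, 0 < eps -> exists A0 : {fset dyadic},
    forall A : {fset dyadic}, (A0 `<=` A)%fset ->
      (L2norm (fun x => (haar_psum sigma g A x - F x)%:E) < eps%:E)%E.

(* For g in L^2 the sum exists and is unique up to a null set, and [Tsigma]
   chooses a representative of it; the default value 0 is only for those g for
   which the series does not converge. *)
Definition Tsigma (sigma : dyadic -> R) (g : R -> R) : R -> R :=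
  xget (fun=> 0) [set F : R -> R | haar_sum sigma g F].

Definition MTM (v w : R -> R) (sigma : dyadic -> R) (f : R -> R)
    : R -> \bar R :=
  fun x => (Num.sqrt (v x) *
    Tsigma sigma (fun y => Num.sqrt (w y) * f y) x)%:E.

Definition alpha (v w : R -> R) (I : dyadic) : R :=
  `|(avg v (left_half I) - avg v (right_half I)) / avg v I|
  * `|(avg w (left_half I) - avg w (right_half I)) / avg w I| * len I.

Definition T0_term (v w f : R -> R) (x : R) (I : dyadic) : R :=
  (len I)^-1 * avg f I * alpha v w I * \1_(dset I) x.

(* [esum] is meant for nonnegative families, whence the two parts.  If both are
   infinite at x, then T0 f x = +oo - oo = -oo, so that T0 f has infinite norm in
   L^2(v) as soon as the series fails to converge absolutely on a set of positive
   measure. *)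
Definition T0 (v w f : R -> R) (x : R) : \bar R :=
  (\esum_(I in [set: dyadic]) (Num.max (T0_term v w f x I) 0)%:E
   - \esum_(I in [set: dyadic]) (Num.max (- T0_term v w f x I) 0)%:E)%E.

End Dyadic.

(* Main.v *)
Require Import Defs.
From HB Require Import structures.
From mathcomp Require Import all_boot all_order all_algebra finmap.
From mathcomp Require Import all_classical all_reals all_analysis.
From mathcomp Require Import measurable_realfun ring lra zify.
Set Implicit Arguments.
Unset Strict Implicit.
Unset Printing Implicit Defensive.
Import Order.TTheory GRing.Theory Num.Theory.
Import numFieldNormedType.Exports.
Local Open Scope classical_set_scope.
Local Open Scope ring_scope.

(** Write [r] and [s] for the square roots of [w] and [v]. Choosing the signs, and
pairing with a second function [g], uniform boundedness of the Haar multipliers is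
the bound
  [sum_I |(r f, h_I)| |(s g, h_I)| <= C |f| |g|]
for all finite sums and all [f], [g] in [L2] ([haar_bounded]). The passage between
full operators and finite sums goes as follows. Two operators whose signs differ on a
finite set differ by twice a finite sum ([haar_sum_flip]); conversely a bound on finite
sums passes to the limit where [v] is bounded. This uses that the Haar series of an
[L2] function does converge ([haar_sum_exists]).

On each interval [I] split [r f = r ^ 2 (f / r)] with respect to the measure [w]: the
average of [f / r] contributes the drop of [w] between the two halves of [I], and the
rest is a Haar coefficient for the measure [w] ([drop_decomp]). Expanding the product
of the two coefficients gives four terms. The product of the averages is, up to a
factor, the bilinear form of [T0]. The sum of the squares of the weighted Haar
coefficients is at most a multiple of the squared norm ([haar_energy_sum]); hence the
term with two of them is bounded under the Muckenhoupt condition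
[<v>_J <w>_J <= C], and each mixed term is bounded as soon as the averages satisfy a
Carleson embedding ([carleson_embedding]), whose hypotheses are the two square function
conditions. Given these three conditions, the Haar form and the form of [T0] are thus
bounded together ([haar_diagonal_close]), which proves sufficiency and leaves the
necessity of the three conditions. The Muckenhoupt condition follows by testing on the
Haar function of the parent interval. For the square function conditions one tests on
the restriction of [r] or [s] to an interval and chooses the signs so that the norm of
the image is at least that of the square function ([signs_pythagoras]).

Both inequalities for weighted coefficients are instances of one principle
([potential_sum]): if a bounded nonnegative function of intervals drops by at least
[d I] when [I] is replaced by its two halves, then all finite sums of [d] are bounded.
For the Haar coefficients the potential is
  [int_I f ^ 2 - (int_I r f) ^ 2 / w(I)],
and for the Carleson embedding [w(I)] is increased by the Carleson mass of [I] (the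
Bellman function of this problem). *)

(** * Square integrable functions *)

Section SquareIntegrable.
Context {R : realType}.
Local Notation mu := (@lebesgue_measure R).
Implicit Types f g h : R -> R.

Definition sqint f : Prop :=
  measurable_fun setT f /\ (\int[mu]_x (f x ^+ 2)%:E < +oo)%E.

Definition nsq f : R := inner f f.

Lemma sqint_measurable f : sqint f -> measurable_fun setT f.
Proof. by case. Qed.

Lemma sqint_le f g : measurable_fun setT f ->
  (forall x, `|f x| <= `|g x|) -> sqint g -> sqint f.
Proof.
move=> mf fg [mg ig]; split=> //; apply: le_lt_trans ig.
apply: ge0_le_integral; first exact: measurableT.
- by move=> x _; rewrite lee_fin sqr_ge0.
- by apply/measurable_EFinP; exact: measurable_funX.
- by apply/measurable_EFinP; exact: measurable_funX.
- move=> x _; rewrite lee_fin -(real_normK (num_real (f x))).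
  by rewrite -(real_normK (num_real (g x))) lerXn2r// nnegrE.
Qed.

Lemma sqint_integrable f : sqint f -> mu.-integrable setT (EFin \o (fun x => f x * f x)).
Proof.
move=> [mf If]; apply/integrableP; split.
  by apply/measurable_EFinP; exact: measurable_funM.
rewrite (_ : (fun x => _) = fun x => (f x ^+ 2)%:E)//.
by apply/funext => x /=; rewrite ger0_norm ?expr2// -expr2 sqr_ge0.
Qed.

Lemma sqintM f g : sqint f -> sqint g ->
  mu.-integrable setT (EFin \o (fun x => f x * g x)).
Proof.
move=> qf qg.
apply: (@le_integrable _ _ _ mu setT measurableT _
  (EFin \o (fun x => f x * f x + g x * g x))) => //.
- apply/measurable_EFinP; apply: measurable_funM; exact: sqint_measurable.
- move=> x _ /=; rewrite lee_fin [leRHS]ger0_norm; last by nra.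
  rewrite ler_norml; apply/andP; split; nra.
- exact: (integrableD measurableT (sqint_integrable qf) (sqint_integrable qg)).
Qed.

Lemma sqintD f g : sqint f -> sqint g -> sqint (fun x => f x + g x).
Proof.
move=> qf qg; split.
  by apply: measurable_funD; exact: sqint_measurable.
have := integrableD measurableT (sqint_integrable qf) (sqintM qf qg).
move/integrableD => /(_ measurableT _
  (integrableD measurableT (sqintM qf qg) (sqint_integrable qg))).
move/integrableP => [_]; congr (_ < _)%E; apply: eq_integral => x _.
rewrite /= (_ : _ + _ = (f x + g x) ^+ 2); last by ring.
by rewrite ger0_norm ?sqr_ge0.
Qed.

Lemma sqint_mul_bounded (M : R) h f : measurable_fun setT h ->
  (forall x, `|h x| <= M) -> sqint f -> sqint (fun x => h x * f x).
Proof.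
move=> mh hM qf.
have M0 : 0 <= M by apply: le_trans (hM 0).
have qMf : sqint (fun x => M * f x).
  split; first by apply: measurable_funM => //; exact: sqint_measurable.
  have /integrableP[_] := @integrableZl _ _ _ mu setT measurableT (M ^+ 2) _ (sqint_integrable qf).
  congr (_ < _)%E; apply: eq_integral => x _ /=.
  by rewrite ger0_norm; [congr EFin; ring | rewrite mulr_ge0 ?sqr_ge0// -expr2 sqr_ge0].
apply: sqint_le qMf; first by apply: measurable_funM => //; exact: sqint_measurable.
by move=> x; rewrite !normrM ler_wpM2r// (ger0_norm M0).
Qed.

Lemma sqintZ (k : R) f : sqint f -> sqint (fun x => k * f x).
Proof. by apply: (@sqint_mul_bounded `|k|). Qed.

Lemma sqintB f g : sqint f -> sqint g -> sqint (fun x => f x - g x).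
Proof.
move=> qf qg; rewrite (_ : (fun _ => _) = fun x => f x + (-1) * g x).
  by apply: sqintD => //; exact: sqintZ.
by apply/funext => x; rewrite mulN1r.
Qed.

Lemma sqint0 : sqint (fun=> 0).
Proof.
by split=> //; under eq_integral do rewrite expr0n /=; rewrite integral0.
Qed.

Lemma sqint_sum (I : Type) (s : seq I) (F : I -> R -> R) :
  (forall i, sqint (F i)) -> sqint (fun x => \sum_(i <- s) F i x).
Proof.
move=> qF; elim: s => [|i s ih].
  by under eq_fun do rewrite big_nil; exact: sqint0.
by under eq_fun do rewrite big_cons; exact: sqintD.
Qed.

Lemma sqint_indic (A : set R) f : measurable A -> sqint f ->
  sqint (fun x => f x * \1_A x).
Proof.
move=> mA qf; under eq_fun do rewrite mulrC.
apply: (@sqint_mul_bounded 1) => // x.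
by rewrite indicE; case: (_ \in _); rewrite ?normr1 ?normr0.
Qed.

Lemma sqint_norm f : sqint f -> sqint (fun x => `|f x|).
Proof.
move=> qf; apply: (sqint_le _ _ qf) => [|x]; last by rewrite normr_id.
by apply: measurableT_comp => //; case: qf.
Qed.

Lemma innerC f g : inner f g = inner g f.
Proof. by apply: eq_Rintegral => x _; rewrite mulrC. Qed.

Lemma innerDl f g h : sqint f -> sqint g -> sqint h ->
  inner (fun x => f x + g x) h = inner f h + inner g h.
Proof.
move=> qf qg qh; rewrite /inner -RintegralD//; try exact: sqintM.
by apply: eq_Rintegral => x _; rewrite mulrDl.
Qed.

Lemma innerDr f g h : sqint f -> sqint g -> sqint h ->
  inner h (fun x => f x + g x) = inner h f + inner h g.
Proof. by move=> *; rewrite !(innerC h) innerDl. Qed.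

Lemma innerBl f g h : sqint f -> sqint g -> sqint h ->
  inner (fun x => f x - g x) h = inner f h - inner g h.
Proof.
move=> qf qg qh; rewrite /inner -RintegralB//; try exact: sqintM.
by apply: eq_Rintegral => x _; rewrite mulrBl.
Qed.

Lemma innerZl (k : R) f h : sqint f -> sqint h ->
  inner (fun x => k * f x) h = k * inner f h.
Proof.
move=> qf qh; rewrite /inner -RintegralZl//; try exact: sqintM.
by apply: eq_Rintegral => x _; rewrite mulrA.
Qed.

Lemma innerZr (k : R) f h : sqint f -> sqint h ->
  inner h (fun x => k * f x) = k * inner h f.
Proof. by move=> *; rewrite !(innerC h) innerZl. Qed.

Lemma inner0l h : inner (fun=> 0) h = 0.
Proof.
rewrite /inner; under eq_Rintegral do rewrite mul0r.
by rewrite Rintegral_cst// mul0r.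
Qed.

Lemma inner_suml (I : Type) (s : seq I) (F : I -> R -> R) h :
  (forall i, sqint (F i)) -> sqint h ->
  inner (fun x => \sum_(i <- s) F i x) h = \sum_(i <- s) inner (F i) h.
Proof.
move=> qF qh; elim: s => [|i s ih].
  by under eq_fun do rewrite big_nil; rewrite inner0l big_nil.
under eq_fun do rewrite big_cons.
by rewrite innerDl ?big_cons ?ih//; exact: sqint_sum.
Qed.

Lemma le_inner f g h k : sqint f -> sqint g -> sqint h -> sqint k ->
  (forall x, f x * g x <= h x * k x) -> inner f g <= inner h k.
Proof. by move=> *; apply: le_Rintegral => //; exact: sqintM. Qed.

Lemma normr_inner f g : sqint f -> sqint g ->
  `|inner f g| <= inner (fun x => `|f x|) (fun x => `|g x|).
Proof.
move=> qf qg; apply: le_trans (le_normr_Rintegral measurableT (sqintM qf qg)) _.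
by rewrite /inner; under eq_Rintegral do rewrite normrM.
Qed.

Lemma nsq_ge0 f : 0 <= nsq f.
Proof. by apply: Rintegral_ge0 => x _; rewrite -expr2 sqr_ge0. Qed.

Lemma nsqE f : sqint f -> (\int[mu]_x (f x ^+ 2)%:E)%E = (nsq f)%:E.
Proof.
move=> qf; rewrite /nsq /inner /Rintegral fineK; last first.
  exact: (integrable_fin_num measurableT (sqint_integrable qf)).
by apply: eq_integral => x _; rewrite expr2.
Qed.

Lemma nsqZ (k : R) f : sqint f -> nsq (fun x => k * f x) = k ^+ 2 * nsq f.
Proof.
move=> qf; have qkf := @sqintZ k _ qf.
by rewrite /nsq innerZl// innerZr// expr2 mulrA.
Qed.

Lemma nsq_norm f : nsq (fun x => `|f x|) = nsq f.
Proof.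
apply: eq_Rintegral => x _.
by rewrite -expr2 real_normK ?num_real.
Qed.

Lemma nsqD f g : sqint f -> sqint g ->
  nsq (fun x => f x + g x) = nsq f + 2 * inner f g + nsq g.
Proof.
move=> qf qg; have qfg := sqintD qf qg.
rewrite /nsq innerDl// !innerDr// (innerC g f); ring.
Qed.

Lemma nsqD_le f g : sqint f -> sqint g ->
  nsq (fun x => f x + g x) <= 2 * nsq f + 2 * nsq g.
Proof.
move=> qf qg; have := nsq_ge0 (fun x => f x + (-1) * g x).
rewrite !nsqD//; last exact: sqintZ.
rewrite nsqZ// innerZr//; lra.
Qed.

Lemma inner_le_nsq f g : sqint f -> sqint g -> 2 * inner f g <= nsq f + nsq g.
Proof.
move=> qf qg; have := nsq_ge0 (fun x => f x + (-1) * g x).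
rewrite nsqD//; last exact: sqintZ.
rewrite nsqZ// innerZr//; lra.
Qed.

(** Turns a bilinear bound by a sum of squares, tested against multiples of the
image itself, into an operator bound. *)
Lemma scaling_bound (C F q : R) : 0 < C ->
  (forall t, 0 < t -> t * q <= C * (F + t ^+ 2 * q)) -> q <= 4 * C ^+ 2 * F.
Proof.
move=> C0 H.
(* this factor makes the quadratic term half of the left-hand side *)
set t := (2 * C)^-1; have t0 : 0 < t by rewrite invr_gt0 mulr_gt0.
have h : 4 * C * (t * q) <= 4 * C * (C * (F + t ^+ 2 * q)).
  by rewrite ler_wpM2l ?H// mulr_ge0// ltW.
have tC : t * C = 2^-1 by rewrite /t; field; rewrite gt_eqF.
rewrite (_ : 4 * C * (t * _) = 4 * (t * C) * q) in h; last by ring.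
rewrite (_ : 4 * C * _ = 4 * C ^+ 2 * F + 4 * (t * C) ^+ 2 * q) in h; last by ring.
rewrite tC in h; rewrite (_ : 4 * 2^-1 ^+ 2 = 1) in h; last by field.
rewrite (_ : 4 * 2^-1 = 2) in h; last by field.
lra.
Qed.

Lemma le_nsq f g : sqint f -> sqint g -> (forall x, `|f x| <= `|g x|) ->
  nsq f <= nsq g.
Proof.
move=> qf qg fg; apply: le_inner => // x.
rewrite -!expr2 -(real_normK (num_real (f x))) -(real_normK (num_real (g x))).
by rewrite lerXn2r// nnegrE.
Qed.

(** Cauchy-Schwarz, from the sign of the discriminant. *)
Lemma inner_sqr_le f g : sqint f -> sqint g ->
  inner f g ^+ 2 <= nsq f * nsq g.
Proof.
move=> qf qg.
have H (k : R) : 0 <= nsq f + 2 * k * inner f g + k ^+ 2 * nsq g.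
  have := nsq_ge0 (fun x => f x + k * g x).
  rewrite nsqD//; last exact: sqintZ.
  by rewrite nsqZ// innerZr// mulrA.
have g0 := nsq_ge0 g.
have [g00|gn0] := eqVneq (nsq g) 0.
  rewrite g00 mulr0.
  have [->|i0] := eqVneq (inner f g) 0; first by rewrite expr0n.
  have := H (- (nsq f + 1) / (2 * inner f g)).
  rewrite g00 mulr0 addr0.
  rewrite (_ : 2 * _ * _ = - (nsq f + 1)); [lra | by field].
have gp : 0 < nsq g by rewrite lt_neqAle eq_sym gn0.
have := H (- inner f g / nsq g).
rewrite (_ : _ + _ = (nsq f * nsq g - inner f g ^+ 2) / nsq g); last by field.
by rewrite ler_pdivlMr// mul0r subr_ge0.
Qed.

End SquareIntegrable.

(** * Dyadic intervals and sums over the dyadic tree *)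

Section DyadicGeometry.
Context {R : realType}.
Local Notation mu := (@lebesgue_measure R).
Implicit Types (I J : dyadic) (x : R).

Lemma len_gt0 I : 0 < len I :> R.
Proof. by rewrite exprz_gt0. Qed.

Lemma len_neq0 I : len I != 0 :> R.
Proof. by rewrite gt_eqF// len_gt0. Qed.

Lemma len_left I : len (left_half I) = len I / 2 :> R.
Proof. by rewrite /len /left_half/= expfzDr. Qed.

Lemma len_right I : len (right_half I) = len I / 2 :> R.
Proof. by rewrite /len /right_half/= expfzDr. Qed.

Lemma in_dset I x :
  dset I x <-> I.2%:~R * len I <= x /\ x < (I.2%:~R + 1) * len I.
Proof.
rewrite /dset /= in_itv /= intrD.
by split => [/andP[]|[-> ->]].
Qed.

Lemma in_dset_left I x :
  dset (left_half I) x <->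
  I.2%:~R * len I <= x /\ x < (I.2%:~R + 2^-1) * len I.
Proof.
rewrite in_dset len_left /left_half /= intrM.
by rewrite (_ : 2%:~R * I.2%:~R * _ = I.2%:~R * len I); [|by field];
   rewrite (_ : (_ + 1) * _ = (I.2%:~R + 2^-1) * len I); [|by field].
Qed.

Lemma in_dset_right I x :
  dset (right_half I) x <->
  (I.2%:~R + 2^-1) * len I <= x /\ x < (I.2%:~R + 1) * len I.
Proof.
rewrite in_dset len_right /right_half /= intrD intrM.
by rewrite (_ : (_ + 1) * (len I / 2) = (I.2%:~R + 2^-1) * len I); [|by field];
   rewrite (_ : (_ + 1 + 1) * _ = (I.2%:~R + 1) * len I); [|by field].
Qed.

Lemma dset_left_sub I : @dset R (left_half I) `<=` dset I.
Proof.
move=> x /in_dset_left[l u]; apply/in_dset; split=> //.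
by apply: (lt_trans u); rewrite ltr_pM2r ?len_gt0// ltrD2l; lra.
Qed.

Lemma dset_right_sub I : @dset R (right_half I) `<=` dset I.
Proof.
move=> x /in_dset_right[l u]; apply/in_dset; split=> //.
by apply: (le_trans _ l); rewrite ler_pM2r ?len_gt0// lerDl; lra.
Qed.

Lemma dset_halves_disj I x : dset (left_half I) x -> ~ dset (right_half I) x.
Proof. move=> /in_dset_left[_ u] /in_dset_right[l _]; lra. Qed.

Lemma dset_halves_cover I x :
  dset I x -> dset (left_half I) x \/ dset (right_half I) x.
Proof.
move=> /in_dset[l u]; have [h|h] := ltP x ((I.2%:~R + 2^-1) * len I).
  by left; apply/in_dset_left.
by right; apply/in_dset_right.
Qed.

Lemma dset_left_end I : @dset R I (I.2%:~R * len I).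
Proof. by apply/in_dset; split=> //; rewrite ltr_pM2r ?len_gt0// ltrDl. Qed.

Lemma dset_sub_halves I J :
  ~ (@dset R I `<=` dset (left_half J) /\ @dset R I `<=` dset (right_half J)).
Proof.
move=> [l r]; have h := dset_left_end I.
exact: (dset_halves_disj (l _ h) (r _ h)).
Qed.

Lemma dset_not_sub_left J : ~ (@dset R J `<=` dset (left_half J)).
Proof.
move=> h; apply: (@dset_halves_disj J (((right_half J).2)%:~R * len (right_half J))).
  by apply: h; apply: dset_right_sub; exact: dset_left_end.
exact: dset_left_end.
Qed.

Lemma dset_not_sub_right J : ~ (@dset R J `<=` dset (right_half J)).
Proof.
move=> h; apply: (@dset_halves_disj J (((left_half J).2)%:~R * len (left_half J))).
  exact: dset_left_end.
by apply: h; apply: dset_left_sub; exact: dset_left_end.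
Qed.

Lemma indic_halves I x :
  \1_(dset I) x = \1_(dset (left_half I)) x + \1_(dset (right_half I)) x :> R.
Proof.
rewrite !indicE; have [h|h] := pselect (dset (left_half I) x).
  rewrite (mem_set h) (mem_set (dset_left_sub h)) memNset ?addr0//.
  exact: dset_halves_disj h.
rewrite (memNset h) add0r; have [k|k] := pselect (dset (right_half I) x).
  by rewrite (mem_set k) (mem_set (dset_right_sub k)).
by rewrite (memNset k) memNset// => /dset_halves_cover[].
Qed.

Lemma indic_halves_mul I x :
  \1_(dset (left_half I)) x * \1_(dset (right_half I)) x = 0 :> R.
Proof.
rewrite !indicE; have [h|h] := pselect (dset (left_half I) x).
  by rewrite (@memNset _ (dset (right_half I))) ?mulr0//; exact: dset_halves_disj h.
by rewrite (memNset h) mul0r.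
Qed.

Lemma indic_sub (A B : set R) x : A `<=` B -> \1_A x * \1_B x = \1_A x :> R.
Proof.
move=> AB; rewrite !indicE; have [h|h] := pselect (A x).
  by rewrite (mem_set h) (mem_set (AB _ h)) mulr1.
by rewrite (memNset h) mul0r.
Qed.

Lemma measurable_dset I : measurable (@dset R I).
Proof. exact: measurable_itv. Qed.

Lemma lebesgue_measure_dset I : mu (@dset R I) = (len I)%:E.
Proof.
rewrite /dset lebesgue_measure_itv /= lte_fin ifT.
  by rewrite -EFinB intrD; congr EFin; rewrite /len; ring.
by rewrite intrD ltr_pM2r ?exprz_gt0// ltrDl.
Qed.

End DyadicGeometry.

(** Listing the first generations makes the sums over the dyadic tree finite sums
that unfold by recursion. *)
Fixpoint descendants (n : nat) (J : dyadic) : seq dyadic :=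
  if n is m.+1 then
    J :: descendants m (left_half J) ++ descendants m (right_half J)
  else [::].

Lemma in_descendants n (I J : dyadic) :
  (I \in descendants n.+1 J) =
  [|| I == J, I \in descendants n (left_half J) | I \in descendants n (right_half J)].
Proof. by rewrite /= inE mem_cat. Qed.

Lemma descendants_half n (I J : dyadic) : I \in descendants n J ->
  (left_half I \in descendants n.+1 J) && (right_half I \in descendants n.+1 J).
Proof.
elim: n J => [//|n ih] J; rewrite in_descendants => /or3P[/eqP ->|/ih|/ih].
- by rewrite !in_descendants !eqxx !orbT.
- by move=> /andP[h1 h2]; rewrite 2!(in_descendants n.+1) h1 h2 !orbT.
- by move=> /andP[h1 h2]; rewrite 2!(in_descendants n.+1) h1 h2 !orbT.
Qed.

Lemma descendants_mono m n (J : dyadic) : (m <= n)%N ->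
  {subset descendants m J <= descendants n J}.
Proof.
elim: m n J => [//|m ih] [//|n] J; rewrite ltnS => mn I.
rewrite !in_descendants => /or3P[->//|/(ih _ _ mn) ->|/(ih _ _ mn) ->];
  by rewrite ?orbT.
Qed.

Lemma mem_descendants (m : nat) (k j s : int) :
  s * 2 ^+ m <= j -> j < (s + 1) * 2 ^+ m ->
  (k, j) \in descendants m.+1 (k + m%:Z, s).
Proof.
elim: m k j => [|m ih] k j.
  rewrite expr0 !mulr1 addr0 => h1 h2; have -> : j = s by lia.
  exact: mem_head.
rewrite exprS => h1 h2; set q := (j %/ 2)%Z.
have jE := divz_eq j 2; have r0 := modz_ge0 j (isT : (2 : int) != 0).
have r2 := ltz_mod j (isT : (2 : int) != 0).
have := ih (k + 1) q; set P := 2 ^+ m in h1 h2 *.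
rewrite -/q in jE; set r := (j %% 2)%Z in jE r0 r2.
have -> : k + 1 + m%:Z = k + m.+1%:Z by lia.
have E1 : s * (2 * P) = 2 * (s * P) by ring.
have E2 : (s + 1) * (2 * P) = 2 * ((s + 1) * P) by ring.
rewrite E1 in h1; rewrite E2 in h2.
move=> /(_ ltac:(lia) ltac:(lia)) /descendants_half /andP[hl hr].
have [r1|r1] : r = 0 \/ r = 1 by lia.
  rewrite (_ : (k, j) = left_half (k + 1, q))// /left_half /=; congr pair; lia.
rewrite (_ : (k, j) = right_half (k + 1, q))// /right_half /=; congr pair; lia.
Qed.

(** No dyadic interval meets both half-lines, so two exhausting sequences of tops,
[[0, 2 ^ N[] and [[- 2 ^ N, 0[], are needed. The generation below the top is at most
[2 * N] because an interval has scale at least [- N]. *)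
Lemma descendants_exhaust (N : nat) (I : dyadic) :
  (absz I.1 + absz I.2 <= N)%N ->
  I \in descendants (N + N).+1 (N%:Z, 0) ++ descendants (N + N).+1 (N%:Z, -1).
Proof.
case: I => k j H; rewrite /= in H.
have [m mE] : exists m : nat, k + m%:Z = N%:Z by exists (absz (N%:Z - k)); lia.
have jm : (absz j < 2 ^ m)%N by apply: leq_ltn_trans (ltn_expl m (isT : (1 < 2)%N)); lia.
have PE : (2 : int) ^+ m = (2 ^ m)%N%:Z by rewrite -natz natrX.
rewrite mem_cat; apply/orP; have [j0|j0] := leP 0 j.
- left; apply: (@descendants_mono m.+1); first lia.
  by rewrite -mE; apply: mem_descendants; rewrite ?mul0r// add0r mul1r PE; lia.
- right; apply: (@descendants_mono m.+1); first lia.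
  by rewrite -mE; apply: mem_descendants; rewrite ?subrr ?mul0r// mulN1r PE; lia.
Qed.

Section TreeSums.
Context {R : realType}.
Implicit Types (d G : dyadic -> R).

Lemma ler_sum_uniq_sub (T : eqType) (A s : seq T) (d : T -> R) :
  (forall x, 0 <= d x) -> uniq A -> {subset A <= s} ->
  \sum_(x <- A) d x <= \sum_(x <- s) d x.
Proof.
move=> d0; elim: A s => [|a A ih] s /=.
  by move=> _ _; rewrite big_nil; apply: sumr_ge0.
move=> /andP[aA uA] sub.
have as_ : a \in s by apply: sub; rewrite inE eqxx.
rewrite big_cons (perm_big _ (perm_to_rem as_)) big_cons lerD2l; apply: ih => // x xA.
have xa : x != a by apply: contraNneq aA => <-.
have := sub x; rewrite inE xA orbT => /(_ isT).
by rewrite (perm_mem (perm_to_rem as_)) inE (negPf xa).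
Qed.

Lemma descendants_sum d G (n : nat) (J : dyadic) :
  (forall I, 0 <= G I) ->
  (forall I, d I + G (left_half I) + G (right_half I) <= G I) ->
  \sum_(I <- descendants n J) d I <= G J.
Proof.
move=> G0 H; elim: n J => [|n ih] J /=; first by rewrite big_nil.
rewrite big_cons big_cat /= (le_trans _ (H J))// -addrA lerD2l.
exact: lerD.
Qed.

(** The summation principle behind both embedding inequalities: a bounded
nonnegative potential whose drop from an interval to its two halves pays for the
term at that interval bounds all finite sums of these terms. The factor 2 counts
the two half-lines. *)
Lemma potential_sum (B : R) d G (A : seq dyadic) : uniq A ->
  (forall I, 0 <= d I) -> (forall I, 0 <= G I <= B) ->
  (forall I, d I + G (left_half I) + G (right_half I) <= G I) ->
  \sum_(I <- A) d I <= 2 * B.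
Proof.
move=> uA d0 GB H.
have G0 I : 0 <= G I by case/andP: (GB I).
set N := (\sum_(I <- A) (absz I.1 + absz I.2))%N.
apply: (@le_trans _ _ (\sum_(I <- descendants (N + N).+1 (N%:Z, 0%Z) ++
    descendants (N + N).+1 (N%:Z, (-1)%Z)) d I)).
  apply: ler_sum_uniq_sub => // I IA; apply: descendants_exhaust.
  by rewrite /N (big_rem I IA) /= leq_addr.
rewrite big_cat mulr_natl mulr2n; apply: lerD.
  by apply: le_trans (descendants_sum _ _ G0 H) _; case/andP: (GB (N%:Z, 0%Z)).
by apply: le_trans (descendants_sum _ _ G0 H) _; case/andP: (GB (N%:Z, (-1)%Z)).
Qed.

End TreeSums.

(** * Bessel and Carleson inequalities on the dyadic tree *)

Section Embedding.
Context {R : realType}.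
Implicit Types (W V a b c K Phi : dyadic -> R) (A : seq dyadic) (I : dyadic).

Definition additive_on_halves a :=
  forall I, a I = a (left_half I) + a (right_half I).

Definition drop a I : R := a (left_half I) - a (right_half I).

(** The square of the Haar coefficient for the measure [W]: this is the exact
drop of the potential [Phi - a ^+ 2 / W] from an interval to its halves. *)
Definition haar_energy W a I : R :=
  (a (left_half I) / W (left_half I) - a (right_half I) / W (right_half I)) ^+ 2
  * (W (left_half I) * W (right_half I) / W I).

Lemma haar_energy_ge0 W a I : (forall I, 0 < W I) -> 0 <= haar_energy W a I.
Proof.
move=> W0; apply: mulr_ge0; first exact: sqr_ge0.
by rewrite divr_ge0 ?mulr_ge0 ?ltW.
Qed.

Lemma haar_energy_sum (B : R) W a Phi A : uniq A -> (forall I, 0 < W I) ->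
  additive_on_halves W -> additive_on_halves a -> additive_on_halves Phi ->
  (forall I, a I ^+ 2 <= Phi I * W I) -> (forall I, Phi I <= B) ->
  \sum_(I <- A) haar_energy W a I <= 2 * B.
Proof.
move=> uA W0 addW adda addPhi aPhi PhiB.
apply: (@potential_sum _ _ _ (fun I => Phi I - a I ^+ 2 / W I)) => // I.
- exact: haar_energy_ge0.
- rewrite subr_ge0 ler_pdivrMr// aPhi /= lerBlDr (le_trans (PhiB I))// lerDl.
  by rewrite divr_ge0 ?sqr_ge0// ltW.
- rewrite le_eqVlt; apply/orP; left; apply/eqP; rewrite /haar_energy (adda I) (addW I) (addPhi I).
  have := W0 (left_half I); have := W0 (right_half I) => w1 w2.
  field; rewrite !gt_eqF// ?addr_gt0//.
Qed.

(** Dyadic Carleson embedding. The potential adds to [W] the Carleson mass [K] of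
the interval, so that the drop also sees the mass [c] sitting at the interval
itself. *)
Lemma carleson_embedding1 (B : R) W a Phi c K A : uniq A ->
  (forall I, 0 < W I) ->
  additive_on_halves W -> additive_on_halves a -> additive_on_halves Phi ->
  (forall I, a I ^+ 2 <= Phi I * W I) -> (forall I, Phi I <= B) ->
  (forall I, 0 <= c I) -> (forall I, 0 <= K I <= W I) ->
  (forall I, c I + K (left_half I) + K (right_half I) <= K I) ->
  \sum_(I <- A) c I * (a I / W I) ^+ 2 <= 8 * B.
Proof.
move=> uA W0 addW adda addPhi aPhi PhiB c0 KW cK.
have K0 I : 0 <= K I by case/andP: (KW I).
have WK0 I : 0 < W I + K I by rewrite ltr_wpDr.
have Phi0 I : 0 <= Phi I by rewrite -(pmulr_lge0 _ (W0 I)) (le_trans _ (aPhi I))// sqr_ge0.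
rewrite (_ : 8 * B = 2 * (4 * B)); last by ring.
apply: (@potential_sum _ _ _ (fun I => 4 * (Phi I - a I ^+ 2 / (W I + K I)))) => // I.
- by rewrite mulr_ge0 ?sqr_ge0.
- rewrite pmulr_rge0// subr_ge0 ler_pdivrMr//; apply/andP; split.
    by apply: (le_trans (aPhi I)); rewrite ler_wpM2l// lerDl.
  rewrite ler_pM2l// lerBlDr (le_trans (PhiB I))// lerDl.
  by rewrite divr_ge0 ?sqr_ge0// ltW.
- have := WK0 (left_half I); have := WK0 (right_half I) => r0 l0.
  set xl := W (left_half I) + K (left_half I) in l0 *.
  set xr := W (right_half I) + K (right_half I) in r0 *.
  have y0 := WK0 I; set y := W I + K I in y0 *; have w0 := W0 I.
  have xy : xl + xr + c I <= y.
    by move: (cK I); rewrite /xl /xr /y (addW I); lra.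
  have y2 : y <= 2 * W I by case/andP: (KW I) => _; rewrite /y; lra.
  have x0 : 0 < xl + xr by rewrite addr_gt0.
  have cI := c0 I.
  (* convexity of x ^ 2 / y; it discards the drop that [haar_energy] measures *)
  have S1 : (a I) ^+ 2 / (xl + xr) <=
      a (left_half I) ^+ 2 / xl + a (right_half I) ^+ 2 / xr.
    rewrite -subr_ge0 (adda I) (_ : _ - _ =
      (a (left_half I) * xr - a (right_half I) * xl) ^+ 2 / (xl * xr * (xl + xr))).
      by rewrite divr_ge0 ?sqr_ge0// ltW// !mulr_gt0.
    by field; rewrite !gt_eqF.
  have S2 : c I * (a I / W I) ^+ 2 <= 4 * (a I ^+ 2 / (xl + xr) - a I ^+ 2 / y).
    have -> : 4 * (a I ^+ 2 / (xl + xr) - a I ^+ 2 / y) =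
        a I ^+ 2 * (4 * (y - (xl + xr)) / ((xl + xr) * y)).
      by field; rewrite !gt_eqF.
    rewrite exprMn mulrCA ler_wpM2l ?sqr_ge0// exprVn.
    rewrite ler_pdivlMr ?mulr_gt0// mulrAC ler_pdivrMr ?exprn_gt0//.
    have h1 : (xl + xr) * y <= (2 * W I) * (2 * W I) by apply: ler_pM; lra.
    have h2 : c I * ((xl + xr) * y) <= c I * ((2 * W I) * (2 * W I)).
      by rewrite ler_wpM2l.
    apply: (le_trans h2); rewrite (_ : _ * _ = 4 * c I * W I ^+ 2); last by ring.
    by rewrite ler_wpM2r ?sqr_ge0//; lra.
  rewrite (addPhi I); lra.
Qed.

Lemma carleson_embedding (B C : R) W a Phi c K A : 0 < C -> uniq A ->
  (forall I, 0 < W I) ->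
  additive_on_halves W -> additive_on_halves a -> additive_on_halves Phi ->
  (forall I, a I ^+ 2 <= Phi I * W I) -> (forall I, Phi I <= B) ->
  (forall I, 0 <= c I) -> (forall I, 0 <= K I <= C * W I) ->
  (forall I, c I + K (left_half I) + K (right_half I) <= K I) ->
  \sum_(I <- A) c I * (a I / W I) ^+ 2 <= 8 * C * B.
Proof.
move=> C0 uA W0 addW adda addPhi aPhi PhiB c0 KW cK.
have := @carleson_embedding1 B W a Phi (fun I => c I / C) (fun I => K I / C) A uA W0
  addW adda addPhi aPhi PhiB.
have -> : \sum_(I <- A) c I / C * (a I / W I) ^+ 2 =
    (\sum_(I <- A) c I * (a I / W I) ^+ 2) / C.
  by rewrite mulr_suml; apply: eq_bigr => I _; rewrite mulrAC.
rewrite ler_pdivrMr// (_ : 8 * B * C = 8 * C * B); last by ring.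
apply.
- by move=> I; rewrite divr_ge0// ltW.
- move=> I; case/andP: (KW I) => k0 k1; rewrite divr_ge0//=; last exact: ltW.
  by rewrite ler_pdivrMr// mulrC.
- by move=> I; rewrite -!mulrDl ler_pM2r ?invr_gt0.
Qed.

(** Replacing the values [a / W] on the halves by their average leaves the term with
[drop W]; what is left over is orthogonal to constants with respect to [W] and is
therefore paid for by [haar_energy]. *)
Lemma drop_decomp W V a I : (forall I, 0 < W I) ->
  additive_on_halves W -> additive_on_halves a ->
  exists x, drop a I = a I / W I * drop W I + x /\
    x ^+ 2 / W I <= 4 * haar_energy W a I.
Proof.
move=> W0 addW adda; have := W0 (left_half I); have := W0 (right_half I) => w1 w2.
exists (2 * (a (left_half I) / W (left_half I) - a (right_half I) / W (right_half I))
  * (W (left_half I) * W (right_half I) / W I)).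
rewrite /drop /haar_energy (adda I) (addW I).
set wl := W (left_half I) in w2 *; set wr := W (right_half I) in w1 *.
set al := a (left_half I); set ar := a (right_half I).
have w0 : 0 < wl + wr by rewrite addr_gt0.
split; first by field; rewrite !gt_eqF.
set d := al / wl - ar / wr; set p := wl * wr / (wl + wr).
have p0 : 0 <= p by rewrite divr_ge0 ?mulr_ge0// ltW.
have pw : p <= wl + wr.
  by rewrite ler_pdivrMr// mulrDl !mulrDr; nra.
clearbody p d; rewrite ler_pdivrMr// !exprMn (_ : 2 ^+ 2 = 4); last by ring.
rewrite -!mulrA ler_wpM2l// !(mulrA d) ler_wpM2l -?expr2 ?sqr_ge0//.
by rewrite expr2 ler_wpM2l.
Qed.

Definition haar_form a b A : R :=
  \sum_(I <- A) (len I)^-1 * (`|drop a I| * `|drop b I|).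

(** The part of [haar_form] that sees only the averages [a / W] and [b / V]; up to a
factor it is the bilinear form of the positive operator. *)
Definition diagonal_form W V a b A : R :=
  \sum_(I <- A) (len I)^-1 *
    (`|a I / W I * drop W I| * `|b I / V I * drop V I|).

Lemma normr_prod_approx (x1 x2 y1 y2 : R) :
  `| `|x1 + x2| * `|y1 + y2| - `|x1| * `|y1| | <=
  `|x1| * `|y2| + `|x2| * `|y1| + `|x2| * `|y2|.
Proof.
rewrite -!normrM; apply: (le_trans (ler_dist_dist _ _)).
rewrite (_ : _ - _ = x1 * y2 + x2 * y1 + x2 * y2); last by ring.
by apply: (le_trans (ler_normD _ _)); rewrite lerD2r ler_normD.
Qed.

Lemma amgm_weight (x y l v : R) : 0 < l -> 0 < v ->
  l^-1 * (`|x| * `|y|) <= 2^-1 * (x ^+ 2 * v / l ^+ 2 + y ^+ 2 / v).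
Proof.
move=> l0 v0; rewrite -subr_ge0 -(real_normK (num_real x)) -(real_normK (num_real y)).
rewrite (_ : _ - _ = (2 * v)^-1 * (`|x| * v / l - `|y|) ^+ 2); last first.
  by field; rewrite !gt_eqF.
by rewrite mulr_ge0 ?sqr_ge0// invr_ge0 mulr_ge0// ltW.
Qed.

(** Of the four terms of the product, the two mixed ones are controlled by Carleson
embeddings and the product of the two remainders by the Muckenhoupt condition. *)
Lemma haar_diagonal_form (C1 C Ba Bb : R) W V a b Phi Psi KW KV A :
  0 < C -> 0 <= C1 -> uniq A ->
  (forall I, 0 < W I) -> (forall I, 0 < V I) ->
  additive_on_halves W -> additive_on_halves V ->
  additive_on_halves a -> additive_on_halves Phi ->
  (forall I, a I ^+ 2 <= Phi I * W I) -> (forall I, Phi I <= Ba) ->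
  additive_on_halves b -> additive_on_halves Psi ->
  (forall I, b I ^+ 2 <= Psi I * V I) -> (forall I, Psi I <= Bb) ->
  (forall I, W I * V I <= C1 * len I ^+ 2) ->
  (forall I, 0 <= KW I <= C * W I) ->
  (forall I, drop W I ^+ 2 * V I / len I ^+ 2 + KW (left_half I) + KW (right_half I)
     <= KW I) ->
  (forall I, 0 <= KV I <= C * V I) ->
  (forall I, drop V I ^+ 2 * W I / len I ^+ 2 + KV (left_half I) + KV (right_half I)
     <= KV I) ->
  `|haar_form a b A - diagonal_form W V a b A| <= (4 * C + 8 + 4 * C1) * (Ba + Bb).
Proof.
move=> C0 C10 uA W0 V0 addW addV adda addPhi aPhi PhiB addb addPsi bPsi PsiB
  A2 KW0 KWc KV0 KVc.
set cW := fun I => drop W I ^+ 2 * V I / len I ^+ 2.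
set cV := fun I => drop V I ^+ 2 * W I / len I ^+ 2.
have cW0 I : 0 <= cW I.
  by rewrite divr_ge0 ?sqr_ge0// mulr_ge0 ?sqr_ge0// ltW.
have cV0 I : 0 <= cV I.
  by rewrite divr_ge0 ?sqr_ge0// mulr_ge0 ?sqr_ge0// ltW.
have T I : `|(len I)^-1 * (`|drop a I| * `|drop b I|) - (len I)^-1 *
    (`|a I / W I * drop W I| * `|b I / V I * drop V I|)| <=
    2^-1 * (cW I * (a I / W I) ^+ 2) + 2^-1 * (cV I * (b I / V I) ^+ 2) +
    (2 + 2 * C1) * haar_energy W a I + 4 * haar_energy V b I.
  have [x [xE xb]] := drop_decomp V I W0 addW adda.
  have [y [yE yb]] := drop_decomp W I V0 addV addb.
  have l0 : 0 < len I :> R := len_gt0 I.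
  rewrite -mulrBr normrM (ger0_norm (ltW _)) ?invr_gt0// xE yE.
  set x1 := a I / W I * _; set y1 := b I / V I * _.
  have i0 : 0 <= (len I)^-1 :> R by rewrite invr_ge0 ltW.
  apply: (le_trans (ler_wpM2l i0 (normr_prod_approx x1 x y1 y))).
  rewrite !mulrDr.
  have e1 := amgm_weight x1 y l0 (V0 I).
  have e2 := amgm_weight y1 x l0 (W0 I).
  have e3 := amgm_weight x y l0 (V0 I).
  have E1 : x1 ^+ 2 * V I / len I ^+ 2 = cW I * (a I / W I) ^+ 2.
    by rewrite /x1 /cW; field; rewrite !gt_eqF.
  have E2 : y1 ^+ 2 * W I / len I ^+ 2 = cV I * (b I / V I) ^+ 2.
    by rewrite /y1 /cV; field; rewrite !gt_eqF.
  have E3 : x ^+ 2 * V I / len I ^+ 2 <= C1 * (x ^+ 2 / W I).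
    rewrite ler_pdivrMr ?exprn_gt0// (_ : C1 * _ * _ =
      x ^+ 2 * (C1 * len I ^+ 2) / W I); last by field; rewrite !gt_eqF.
    rewrite ler_pdivlMr// -mulrA ler_wpM2l ?sqr_ge0// mulrC; exact: A2.
  have E4 : C1 * (x ^+ 2 / W I) <= C1 * (4 * haar_energy W a I) by exact: ler_wpM2l.
  rewrite E1 in e1; rewrite E2 (mulrC `|y1|) in e2.
  lra.
rewrite /haar_form /diagonal_form -sumrB.
apply: (le_trans (ler_norm_sum _ _ _)).
apply: (le_trans (ler_sum _ (fun I _ => T I))).
rewrite !big_split /= -!mulr_sumr.
have s1 := carleson_embedding C0 uA W0 addW adda addPhi aPhi PhiB cW0 KW0 KWc.
have s2 := carleson_embedding C0 uA V0 addV addb addPsi bPsi PsiB cV0 KV0 KVc.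
have s3 := haar_energy_sum uA W0 addW adda addPhi aPhi PhiB.
have s4 := haar_energy_sum uA V0 addV addb addPsi bPsi PsiB.
have Ba0 : 0 <= Ba.
  by rewrite (le_trans _ (PhiB (0, 0)))// -(pmulr_lge0 _ (W0 (0, 0)))
    (le_trans _ (aPhi _))// sqr_ge0.
have Bb0 : 0 <= Bb.
  by rewrite (le_trans _ (PsiB (0, 0)))// -(pmulr_lge0 _ (V0 (0, 0)))
    (le_trans _ (bPsi _))// sqr_ge0.
have s5 : (2 + 2 * C1) * \sum_(I <- A) haar_energy W a I <= (2 + 2 * C1) * (2 * Ba).
  by apply: ler_wpM2l => //; lra.
have s6 : 0 <= C1 * Bb by exact: mulr_ge0.
have s7 : 0 <= C1 * Ba by exact: mulr_ge0.
lra.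
Qed.

End Embedding.

(** * Haar forms of two weights *)

Section WeightedHaar.
Context {R : realType}.
Local Notation mu := (@lebesgue_measure R).
Implicit Types (r s f g : R -> R) (I J : dyadic) (A : seq dyadic).

(** Here [r] is the square root of a weight. Thus [coef r f I] is the integral of the
flattened function [r * f] over [I], and [mass r I] is the weight of [I]. *)
Definition restr r I : R -> R := fun x => r x * \1_(dset I) x.

Definition locally_sqint r : Prop := forall I, sqint (restr r I).

Definition coef r f I : R := inner (restr r I) f.

Definition mass r I : R := nsq (restr r I).

Definition weighted_haar r I : R -> R := fun x => r x * haar I x.

Lemma sqint_restr f I : sqint f -> sqint (restr f I).
Proof. by apply: sqint_indic; exact: measurable_dset. Qed.

Lemma restr_halves r I x :
  restr r I x = restr r (left_half I) x + restr r (right_half I) x.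
Proof. by rewrite /restr indic_halves mulrDr. Qed.

Lemma coef_additive r f : locally_sqint r -> sqint f ->
  additive_on_halves (coef r f).
Proof.
move=> qr qf I; rewrite /coef -innerDl//; congr (inner _ f).
by apply/funext => x; exact: restr_halves.
Qed.

Lemma mass_additive r : locally_sqint r -> additive_on_halves (mass r).
Proof.
move=> qr I; rewrite /mass (_ : restr r I = fun x =>
    restr r (left_half I) x + restr r (right_half I) x); last first.
  by apply/funext => x; exact: restr_halves.
rewrite nsqD// (_ : inner _ _ = 0) ?mulr0 ?addr0//.
rewrite -(inner0l (fun=> 0)); apply: eq_Rintegral => x _.
by rewrite /restr mulrACA indic_halves_mul !mulr0.
Qed.

Lemma mass_le f I : sqint f -> mass f I <= nsq f.
Proof.
move=> qf; apply: le_nsq => //; first exact: sqint_restr.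
move=> x; rewrite /restr normrM ler_piMr// indicE.
by case: (_ \in _); rewrite ?normr1 ?normr0.
Qed.

Lemma inner_restr r g I J : @dset R I `<=` dset J ->
  inner (restr r I) (restr g J) = inner (restr r I) g.
Proof.
move=> IJ; apply: eq_Rintegral => x _.
by rewrite /restr mulrACA indic_sub// mulrAC.
Qed.

Lemma coef_sqr_le r f I : locally_sqint r -> sqint f ->
  coef r f I ^+ 2 <= mass f I * mass r I.
Proof.
move=> qr qf; rewrite /coef -(@inner_restr r f I I)// mulrC.
by apply: inner_sqr_le => //; exact: sqint_restr.
Qed.

Lemma coef_restr r I J : @dset R I `<=` dset J ->
  coef r (restr r J) I = mass r I.
Proof. by move=> IJ; rewrite /coef inner_restr// -(@inner_restr r r I I). Qed.

Lemma coef_restr_disj r I J : (forall x, dset I x -> ~ @dset R J x) ->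
  coef r (restr r J) I = 0.
Proof.
move=> IJ; rewrite -(inner0l (fun=> 0)); apply: eq_Rintegral => x _.
rewrite /restr !indicE; have [h|h] := pselect (dset I x).
  by rewrite (memNset (IJ _ h)) !mulr0.
by rewrite (memNset h) !mulr0 !mul0r.
Qed.

Lemma coefZ r f k I : locally_sqint r -> sqint f ->
  coef r (fun x => k * f x) I = k * coef r f I.
Proof. by move=> qr qf; rewrite /coef innerZr. Qed.

Lemma weighted_haarE r I : weighted_haar r I =
  fun x => (Num.sqrt (len I))^-1 *
    (restr r (left_half I) x - restr r (right_half I) x).
Proof. by apply/funext => x; rewrite /weighted_haar /haar /restr; ring. Qed.

Lemma sqint_weighted_haar r I : locally_sqint r -> sqint (weighted_haar r I).
Proof.
by move=> qr; rewrite weighted_haarE; apply: sqintZ; exact: sqintB.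
Qed.

Lemma inner_weighted_haar r f I : locally_sqint r -> sqint f ->
  inner (weighted_haar r I) f = (Num.sqrt (len I))^-1 * drop (coef r f) I.
Proof.
move=> qr qf; rewrite weighted_haarE innerZl//; last exact: sqintB.
by rewrite innerBl.
Qed.

Lemma inner_haar r f I :
  inner (fun x => r x * f x) (haar I) = inner (weighted_haar r I) f.
Proof. by apply: eq_Rintegral => x _; rewrite /weighted_haar mulrAC. Qed.

Lemma sqrt_len_mul I : (Num.sqrt (len I))^-1 * (Num.sqrt (len I))^-1 = (len I)^-1 :> R.
Proof. by rewrite -invfM -expr2 sqr_sqrtr// ltW// len_gt0. Qed.

Lemma sqrt_len_inv_ge0 I : 0 <= (Num.sqrt (len I))^-1 :> R.
Proof. by rewrite invr_ge0 sqrtr_ge0. Qed.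

Lemma nsq_weighted_haar s I : locally_sqint s ->
  nsq (weighted_haar s I) = mass s I / len I.
Proof.
move=> qs; rewrite weighted_haarE nsqZ; last exact: sqintB.
rewrite expr2 sqrt_len_mul mulrC; congr (_ / _).
apply: eq_Rintegral => x _; rewrite (restr_halves s I x).
have : restr s (left_half I) x * restr s (right_half I) x = 0.
  by rewrite /restr mulrACA indic_halves_mul mulr0.
move: (restr s (left_half I) x) (restr s (right_half I) x) => p q pq.
have -> : (p - q) * (p - q) = (p + q) * (p + q) - 4 * (p * q) by ring.
by rewrite pq mulr0 subr0.
Qed.

Lemma haar_formE r s f g A : locally_sqint r -> locally_sqint s ->
  sqint f -> sqint g ->
  haar_form (coef r f) (coef s g) A =
  \sum_(I <- A) `|inner (weighted_haar r I) f| * `|inner (weighted_haar s I) g|.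
Proof.
move=> *; apply: eq_bigr => I _; rewrite !inner_weighted_haar// !normrM.
by rewrite (ger0_norm (sqrt_len_inv_ge0 I)) mulrACA sqrt_len_mul.
Qed.

(** Bilinear bounds are stated with the sum, not the product, of the two squared
norms; the product form follows by scaling one of the functions. *)
Definition haar_bounded r s : Prop := exists2 C : R, 0 < C &
  forall f g A, sqint f -> sqint g -> uniq A ->
  haar_form (coef r f) (coef s g) A <= C * (nsq f + nsq g).

Definition diagonal_bounded r s : Prop := exists2 C : R, 0 < C &
  forall f g A, sqint f -> sqint g -> uniq A ->
  diagonal_form (mass r) (mass s) (coef r f) (coef s g) A <= C * (nsq f + nsq g).

Definition multiplier_sum r s (sigma : dyadic -> R) f A : R -> R :=
  fun x => \sum_(I <- A) sigma I * inner (weighted_haar r I) f * weighted_haar s I x.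

Definition multipliers_bounded r s : Prop := exists2 C : R, 0 < C &
  forall sigma f A, signs sigma -> sqint f -> uniq A ->
  nsq (multiplier_sum r s sigma f A) <= C * nsq f.

Definition muckenhoupt r s : Prop := exists C : R,
  forall J, mass r J * mass s J <= C * len J ^+ 2.

Definition testing_mass r s I : R := drop (mass r) I ^+ 2 * mass s I / len I ^+ 2.

Definition testing r s : Prop := exists C : R, forall J A, uniq A ->
  (forall I, I \in A -> @dset R I `<=` dset J) ->
  \sum_(I <- A) testing_mass r s I <= C * mass r J.

Lemma haar_boundedC r s : haar_bounded r s -> haar_bounded s r.
Proof.
move=> [C C0 H]; exists C => // f g A qf qg uA; rewrite addrC.
by apply: le_trans (H g f A qg qf uA); apply: ler_sum => I _; rewrite (mulrC `|_|).
Qed.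

Lemma sqint_multiplier_sum r s sigma f A : locally_sqint s ->
  sqint (multiplier_sum r s sigma f A).
Proof.
by move=> qs; apply: sqint_sum => I; apply: sqintZ; exact: sqint_weighted_haar.
Qed.

Lemma inner_multiplier_sum r s sigma f g A : locally_sqint s -> sqint g ->
  inner (multiplier_sum r s sigma f A) g =
  \sum_(I <- A) sigma I * inner (weighted_haar r I) f * inner (weighted_haar s I) g.
Proof.
move=> qs qg; rewrite /multiplier_sum inner_suml//.
  by apply: eq_bigr => I _; rewrite innerZl//; exact: sqint_weighted_haar.
by move=> I; apply: sqintZ; exact: sqint_weighted_haar.
Qed.

(** The square of the norm of a finite multiplier sum is its pairing with itself, and
this pairing is at most the Haar form of the function and the sum. *)
Lemma haar_multipliers_bounded r s : locally_sqint r -> locally_sqint s ->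
  haar_bounded r s -> multipliers_bounded r s.
Proof.
move=> qr qs [C C0 H]; exists (4 * C ^+ 2) => [|sigma f A sg qf uA].
  by rewrite mulr_gt0// exprn_gt0.
set Q := multiplier_sum _ _ _ _ _.
have qQ : sqint Q by exact: sqint_multiplier_sum.
apply: scaling_bound => // t t0.
have := H f (fun x => t * Q x) A qf (sqintZ _ qQ) uA.
rewrite haar_formE//; last exact: sqintZ.
rewrite nsqZ//; apply: le_trans.
rewrite {1}/nsq inner_multiplier_sum// mulr_sumr.
apply: ler_sum => I _; rewrite innerZr//; last exact: sqint_weighted_haar.
apply: le_trans (ler_norm _) _; rewrite !normrM (gtr0_norm t0).
have -> : `|sigma I| = 1 by case: (sg I) => ->; rewrite ?normrN normr1.
by rewrite mul1r mulrCA.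
Qed.

(** The signs of the products of coefficients turn the Haar form into a pairing with
one multiplier sum. *)
Lemma multipliers_haar_bounded r s : locally_sqint r -> locally_sqint s ->
  multipliers_bounded r s -> haar_bounded r s.
Proof.
move=> qr qs [C C0 H]; exists (C + 1) => [|f g A qf qg uA]; first by lra.
rewrite haar_formE//.
pose sigma I : R :=
  if 0 <= inner (weighted_haar r I) f * inner (weighted_haar s I) g then 1 else -1.
have sg : signs sigma by move=> I; rewrite /sigma; case: ifP; [left|right].
have := H sigma f A sg qf uA.
have := inner_le_nsq (sqint_multiplier_sum r sigma f A qs) qg.
rewrite inner_multiplier_sum//.
rewrite (eq_bigr (fun I => `|inner (weighted_haar r I) f| *
    `|inner (weighted_haar s I) g|)); last first.
  move=> I _; rewrite -normrM -mulrA /sigma; case: ifPn => h.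
    by rewrite mul1r ger0_norm.
  by rewrite mulN1r ltr0_norm// ltNge.
have f0 := nsq_ge0 f; have g0 := nsq_ge0 g; have := mulr_ge0 (ltW C0) g0.
have := mulr_ge0 (ltW C0) f0; lra.
Qed.

(** Muckenhoupt condition: the Haar function of the parent of [J] is constant on
[J], so the functions supported on [J] see only a product of two masses. *)
Lemma haar_bounded_muckenhoupt r s : locally_sqint r -> locally_sqint s ->
  (forall I, 0 < mass r I) -> haar_bounded r s -> muckenhoupt r s.
Proof.
move=> qr qs mr0 [C C0 H]; exists (16 * C ^+ 2) => J.
have [P [lP dr ds]] : exists P, [/\ len P = 2 * len J :> R,
    `|drop (coef r (restr r J)) P| = mass r J &
    `|drop (coef s (restr s J)) P| = mass s J].
  case: J => k j; set q := (j %/ 2)%Z.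
  have jE := divz_eq j 2; have r0 := modz_ge0 j (isT : (2 : int) != 0).
  have r2 := ltz_mod j (isT : (2 : int) != 0).
  have disj' x : dset (right_half (k + 1, q)) x -> ~ @dset R (left_half (k + 1, q)) x.
    by move=> h1 h2; exact: dset_halves_disj h2 h1.
  have m0 t I : 0 <= mass t I by exact: nsq_ge0.
  exists (k + 1, q).
  have [r1|r1] : (j %% 2)%Z = 0 \/ (j %% 2)%Z = 1 by lia.
  - have -> : (k, j) = left_half (k + 1, q) by rewrite /left_half /=; congr pair; lia.
    rewrite len_left /drop !(coef_restr _ (@subset_refl _ (dset (left_half _)))).
    rewrite !(coef_restr_disj _ disj') !subr0 !ger0_norm//.
    by split=> //; field.
  - have -> : (k, j) = right_half (k + 1, q) by rewrite /right_half /=; congr pair; lia.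
    rewrite len_right /drop !(coef_restr _ (@subset_refl _ (dset (right_half _)))).
    rewrite !(coef_restr_disj _ (@dset_halves_disj _ _)) !sub0r !normrN !ger0_norm//.
    by split=> //; field.
have lJ : 0 < len J :> R := len_gt0 J.
(* this multiple makes the left-hand side twice the second term on the right *)
set lam := 4 * C * len J / mass r J.
have lam0 : 0 < lam by rewrite divr_gt0// !mulr_gt0.
have qrJ := qr J.
have := H (fun x => lam * restr r J x) (restr s J) [:: P] (sqintZ _ qrJ) (qs J) isT.
rewrite /haar_form big_seq1 ds nsqZ// -/(mass r J) -/(mass s J).
rewrite (_ : drop _ P = lam * drop (coef r (restr r J)) P); last first.
  by rewrite /drop !coefZ// mulrBr.
rewrite normrM dr (gtr0_norm lam0) lP.
have w0 := mr0 J.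
rewrite (_ : _ * (lam * _ * _) = 2 * C * mass s J); last first.
  by rewrite /lam; field; rewrite !gt_eqF.
rewrite (_ : lam ^+ 2 * mass r J = 16 * C ^+ 2 * len J ^+ 2 / mass r J); last first.
  by rewrite /lam; field; rewrite !gt_eqF.
rewrite (_ : 2 * C * mass s J = C * (2 * mass s J)) ?ler_pM2l//; last by ring.
move=> h; have : mass s J <= 16 * C ^+ 2 * len J ^+ 2 / mass r J by lra.
by rewrite ler_pdivlMr// mulrC.
Qed.

(** The signs are chosen one after another so that no cross term is negative. This
replaces averaging over all signs. *)
Lemma signs_pythagoras (T : dyadic -> R -> R) A : (forall I, sqint (T I)) -> uniq A ->
  exists2 sigma, signs sigma &
  \sum_(I <- A) nsq (T I) <= nsq (fun x => \sum_(I <- A) sigma I * T I x).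
Proof.
move=> qT; elim: A => [_|I A ih /= /andP[IA uA]].
  by exists (fun=> 1); [left | rewrite big_nil nsq_ge0].
have [sigma sg le] := ih uA.
set F := fun x => \sum_(J <- A) sigma J * T J x in le.
have qF : sqint F by apply: sqint_sum => J; exact: sqintZ.
pose e : R := if 0 <= inner (T I) F then 1 else -1.
have e2 : e ^+ 2 = 1 by rewrite /e; case: ifP; rewrite ?sqrrN expr1n.
have ep : 0 <= e * inner (T I) F.
  by rewrite /e; case: ifPn => h; rewrite ?mul1r// mulN1r oppr_ge0 ltW// ltNge.
exists (fun J => if J == I then e else sigma J).
  by move=> J; case: eqP => // _; rewrite /e; case: ifP; [left|right].
rewrite big_cons (_ : (fun x => \sum_(J <- I :: A) _) = fun x => e * T I x + F x).
  rewrite nsqD//; last exact: sqintZ.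
  rewrite nsqZ// innerZl// e2 mul1r; lra.
apply/funext => x; rewrite big_cons eqxx; congr (_ + _).
rewrite /F big_seq [RHS]big_seq; apply: eq_bigr => J JA.
by case: eqP => // JI; rewrite -JI JA in IA.
Qed.

(** Tested on the restriction of [r] to [J], a multiplier sum has coefficients given by
the drops of the mass; good signs bound its norm below by the square function. *)
Lemma multipliers_bounded_testing r s : locally_sqint r -> locally_sqint s ->
  multipliers_bounded r s -> testing r s.
Proof.
move=> qr qs [C C0 H]; exists C => J A uA AJ.
pose T I x := inner (weighted_haar r I) (restr r J) * weighted_haar s I x.
have qT I : sqint (T I) by apply: sqintZ; exact: sqint_weighted_haar.
have [sigma sg le] := signs_pythagoras qT uA.
have := H sigma (restr r J) A sg (qr J) uA; apply: le_trans.
rewrite (_ : multiplier_sum _ _ _ _ _ = fun x => \sum_(I <- A) sigma I * T I x).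
  apply: le_trans le; rewrite big_seq [leRHS]big_seq.
  apply: ler_sum => I /AJ IJ; rewrite /T nsqZ; last exact: sqint_weighted_haar.
  rewrite nsq_weighted_haar// inner_weighted_haar// exprMn [in leRHS]expr2 sqrt_len_mul.
  rewrite /drop !coef_restr //.
  - rewrite /testing_mass /drop le_eqVlt; apply/orP; left; apply/eqP.
    by field; exact: len_neq0.
  - by apply: subset_trans IJ; exact: dset_right_sub.
  - by apply: subset_trans IJ; exact: dset_left_sub.
by apply/funext => x; apply: eq_bigr => I _; rewrite /T mulrA.
Qed.

(** The total testing mass below an interval is the Carleson mass that
[carleson_embedding] asks for. *)
Lemma testing_potential r s : testing r s ->
  exists2 C : R, 0 < C & exists K : dyadic -> R,
    (forall I, 0 <= K I <= C * mass r I) /\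
    (forall I, testing_mass r s I + K (left_half I) + K (right_half I) <= K I).
Proof.
move=> [C H]; exists (`|C| + 1); first by rewrite ltr_wpDl.
pose S J := [set \sum_(I <- A) testing_mass r s I | A in
  [set A | uniq A /\ forall I, I \in A -> @dset R I `<=` dset J]].
have S0 J : S J 0 by exists [::]; rewrite ?big_nil.
have SC J x : S J x -> x <= C * mass r J by move=> [A [uA AJ] <-]; exact: H.
have hS J : has_sup (S J) by split; [exists 0; exact: S0 | exists (C * mass r J) => x; exact: SC].
exists (fun J => sup (S J)); split=> J.
  apply/andP; split; first by apply: (ub_le_sup _ (S0 J)); case: (hS J).
  apply: (@le_trans _ _ (C * mass r J)); first by apply: ge_sup; [exists 0; exact: S0 | exact: SC].
  rewrite ler_wpM2r ?nsq_ge0//; have := ler_norm C; lra.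
have key x y : S (left_half J) x -> S (right_half J) y ->
    testing_mass r s J + x + y <= sup (S J).
  move=> [A [uA AJ] <-] [B [uB BJ] <-].
  apply: ub_le_sup; first by case: (hS J).
  exists (J :: A ++ B); last by rewrite big_cons big_cat addrA.
  split.
    rewrite /= mem_cat cat_uniq uA uB negb_or andbT /= -andbA; apply/and3P; split.
    - by apply/negP => /AJ; exact: dset_not_sub_left.
    - by apply/negP => /BJ; exact: dset_not_sub_right.
    - apply/hasPn => I IB; apply/negP => IA; apply: (@dset_sub_halves R I J).
      by split; [exact: AJ|exact: BJ].
  move=> I; rewrite inE mem_cat => /or3P[/eqP -> //|/AJ h|/BJ h].
    by apply: subset_trans h _; exact: dset_left_sub.
  by apply: subset_trans h _; exact: dset_right_sub.
have k1 y : S (right_half J) y ->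
    sup (S (left_half J)) <= sup (S J) - testing_mass r s J - y.
  by move=> Sy; apply: ge_sup; [exists 0; exact: S0 | move=> x Sx; have := key x y Sx Sy; lra].
have : sup (S (right_half J)) <= sup (S J) - testing_mass r s J - sup (S (left_half J)).
  by apply: ge_sup; [exists 0; exact: S0 | move=> y Sy; have := k1 y Sy; lra].
lra.
Qed.

(** The diagonal form is bounded exactly when the Haar form is, once the three other
conditions hold: this comparison serves in both directions. *)
Lemma haar_diagonal_close r s : locally_sqint r -> locally_sqint s ->
  (forall I, 0 < mass r I) -> (forall I, 0 < mass s I) ->
  muckenhoupt r s -> testing r s -> testing s r ->
  exists2 C : R, 0 < C & forall f g A, sqint f -> sqint g -> uniq A ->
  `|haar_form (coef r f) (coef s g) A -
    diagonal_form (mass r) (mass s) (coef r f) (coef s g) A| <= C * (nsq f + nsq g).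
Proof.
move=> qr qs mr0 ms0 [C0 A2] /testing_potential[C1 C10 [K1 [K1C K1c]]].
move=> /testing_potential[C2 C20 [K2 [K2C K2c]]].
have C3 : 0 < C1 + C2 by rewrite addr_gt0.
exists (4 * (C1 + C2) + 8 + 4 * `|C0|); first by rewrite ltr_wpDr// addr_gt0// mulr_gt0.
move=> f g A qf qg uA.
apply: (@haar_diagonal_form _ `|C0| (C1 + C2) (nsq f) (nsq g) _ _ _ _ (mass f) (mass g) K1 K2) => //.
- exact: mass_additive.
- exact: mass_additive.
- exact: coef_additive.
- by apply: mass_additive => I; exact: sqint_restr.
- by move=> I; exact: coef_sqr_le.
- by move=> I; exact: mass_le.
- exact: coef_additive.
- by apply: mass_additive => I; exact: sqint_restr.
- by move=> I; exact: coef_sqr_le.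
- by move=> I; exact: mass_le.
- by move=> I; apply: (le_trans (A2 I)); rewrite ler_wpM2r ?sqr_ge0// ler_norm.
- move=> I; case/andP: (K1C I) => -> h /=; apply: (le_trans h).
  by rewrite ler_wpM2r ?nsq_ge0// lerDl ltW.
- move=> I; case/andP: (K2C I) => -> h /=; apply: (le_trans h).
  by rewrite ler_wpM2r ?nsq_ge0// lerDr ltW.
Qed.

Lemma haar_bounded_iff r s : locally_sqint r -> locally_sqint s ->
  (forall I, 0 < mass r I) -> (forall I, 0 < mass s I) ->
  haar_bounded r s <->
  [/\ muckenhoupt r s, testing r s, testing s r & diagonal_bounded r s].
Proof.
move=> qr qs mr0 ms0; split=> [H|[A2 T1 T2 [C C0 D]]].
  have A2 := haar_bounded_muckenhoupt qr qs mr0 H.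
  have T1 := multipliers_bounded_testing qr qs (haar_multipliers_bounded qr qs H).
  have T2 := multipliers_bounded_testing qs qr
    (haar_multipliers_bounded qs qr (haar_boundedC H)).
  have [C C0 D] := haar_diagonal_close qr qs mr0 ms0 A2 T1 T2.
  split=> //; case: H => C' C'0 H; exists (C' + C); first exact: addr_gt0.
  move=> f g A qf qg uA; have := H f g A qf qg uA; have := D f g A qf qg uA.
  by rewrite ler_norml => /andP[h1 h2] h3; lra.
have [C' C'0 D'] := haar_diagonal_close qr qs mr0 ms0 A2 T1 T2.
exists (C' + C); first exact: addr_gt0.
move=> f g A qf qg uA; have := D f g A qf qg uA; have := D' f g A qf qg uA.
by rewrite ler_norml => /andP[h1 h2] h3; lra.
Qed.

End WeightedHaar.

(** * Operator norms and roots of weights *)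

Section OperatorNorms.
Context {R : realType}.
Local Notation mu := (@lebesgue_measure R).

Lemma abse_poweR2 (x : \bar R) : (`|x| `^ 2 = x * x)%E.
Proof.
case: x => [x| |] /=; rewrite ?poweRyr ?pnatr_eq0//.
by rewrite powR_mulrn// real_normK ?num_real// expr2.
Qed.

Lemma abse_expe2 (x : \bar R) : (`|x| ^+ 2 = x * x)%E.
Proof.
by rewrite expe2; case: x => [x| |] //=; rewrite -!EFinM -normrM ger0_norm// -expr2 sqr_ge0.
Qed.

Lemma L2normE (F : R -> \bar R) :
  L2norm F = ((\int[mu]_x (F x * F x)) `^ 2^-1)%E.
Proof.
rewrite /L2norm unlock; congr (_ `^ _)%E.
by apply: eq_integral => x _; rewrite abse_poweR2.
Qed.

Lemma wL2normE (omega : R -> R) (F : R -> \bar R) :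
  wL2norm omega F = ((\int[mu]_x (F x * F x * (omega x)%:E)) `^ 2^-1)%E.
Proof.
by rewrite /wL2norm; congr (_ `^ _)%E; apply: eq_integral => x _; rewrite abse_expe2.
Qed.

Lemma lee_poweR_half (X Y : \bar R) (c : R) : (0 <= X)%E -> (0 <= Y)%E -> 0 <= c ->
  (X `^ 2^-1 <= c%:E * Y `^ 2^-1)%E = (X <= (c ^+ 2)%:E * Y)%E.
Proof.
move=> X0 Y0 c0.
have half (Z : \bar R) : (0 <= Z)%E -> ((Z `^ 2^-1) `^ 2 = Z)%E.
  by move=> Z0; rewrite -poweRrM mulVf// poweRe1.
have c2 : ((c ^+ 2)%:E `^ 2^-1 = c%:E)%E.
  by rewrite poweR12_sqrt ?lee_fin ?sqr_ge0//= sqrtr_sqr ger0_norm.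
apply/idP/idP => h.
  rewrite -(half _ X0) (_ : ((c ^+ 2)%:E * Y = (c%:E * Y `^ 2^-1) `^ 2)%E).
    apply: gt0_ler_poweR => //; rewrite in_itv /= leey andbT ?poweR_ge0//.
    by rewrite mule_ge0 ?lee_fin ?poweR_ge0.
  rewrite poweRM ?poweR_ge0 ?lee_fin// half//; congr (_ * _)%E.
  by rewrite /= powR_mulrn.
rewrite -c2 -poweRM ?lee_fin ?sqr_ge0//.
by apply: gt0_ler_poweR => //; rewrite in_itv /= leey andbT// mule_ge0 ?lee_fin ?sqr_ge0.
Qed.

Lemma poweR_half_lty (X : \bar R) : (0 <= X)%E ->
  (X `^ 2^-1 < +oo)%E = (X < +oo)%E.
Proof.
case: X => [x| |]// _; first by rewrite !ltry.
by rewrite poweRyr// invr_eq0 pnatr_eq0.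
Qed.

(** Bounds between squared norms avoid roots; a finite supremum of the best constants
provides one constant for all operators of the family. *)
Lemma sup_opnorm_lty (S : Type) (P : set S) (D : set (R -> R))
    (N1 N2 : (R -> \bar R) -> \bar R) (T : S -> (R -> R) -> (R -> \bar R))
    (Q1 : (R -> R) -> \bar R) (Q2 : S -> (R -> R) -> \bar R) :
  (forall f, D f -> N1 (EFin \o f) = (Q1 f `^ 2^-1)%E /\ (0 <= Q1 f)%E) ->
  (forall s f, P s -> D f -> N2 (T s f) = (Q2 s f `^ 2^-1)%E /\ (0 <= Q2 s f)%E) ->
  (ereal_sup [set opnorm D N1 N2 (T s) | s in P] < +oo)%E <->
  exists2 C : R, 0 < C & forall s f, P s -> D f -> (Q2 s f <= C%:E * Q1 f)%E.
Proof.
move=> N1E N2E; set X := ereal_sup _; split=> [Xoo|[C C0 H]]; last first.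
  apply: (@le_lt_trans _ _ (Num.sqrt C)%:E); last exact: ltry.
  apply: ge_ereal_sup => _ [s Ps <-]; apply: ereal_inf_lbound.
  exists (Num.sqrt C) => //; split; first exact: sqrtr_ge0.
  move=> f Df; have [-> q1] := N1E f Df; have [-> q2] := N2E s f Ps Df.
  by rewrite lee_poweR_half// sqr_sqrtr ?H// ltW.
have [c c0 Xc] : exists2 c : R, 0 < c & (X < c%:E)%E.
  move: Xoo; case: X => [x| |]// _; last by exists 1; rewrite ?ltNyr.
  exists (`|x| + 1); first by rewrite ltr_wpDl.
  by rewrite lte_fin; have := ler_norm x; lra.
exists (c ^+ 2); first by rewrite exprn_gt0.
move=> s f Ps Df; have [n1 q1] := N1E f Df; have [n2 q2] := N2E s f Ps Df.
rewrite -lee_poweR_half// -?n1 -?n2//; last exact: ltW.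
have : (opnorm D N1 N2 (T s) < c%:E)%E.
  by apply: le_lt_trans Xc; apply: ereal_sup_ubound; exists s.
move=> /ereal_inf_lt[_ [d [d0 dT] <-]]; rewrite lte_fin => dc.
apply: (le_trans (dT f Df)); apply: lee_wpmul2r; last by rewrite lee_fin ltW.
by rewrite n1 poweR_ge0.
Qed.

Lemma opnorm_lty (D : set (R -> R))
    (N1 N2 : (R -> \bar R) -> \bar R) (T : (R -> R) -> (R -> \bar R))
    (Q1 Q2 : (R -> R) -> \bar R) :
  (forall f, D f -> N1 (EFin \o f) = (Q1 f `^ 2^-1)%E /\ (0 <= Q1 f)%E) ->
  (forall f, D f -> N2 (T f) = (Q2 f `^ 2^-1)%E /\ (0 <= Q2 f)%E) ->
  (opnorm D N1 N2 T < +oo)%E <->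
  exists2 C : R, 0 < C & forall f, D f -> (Q2 f <= C%:E * Q1 f)%E.
Proof.
move=> H1 H2.
have := @sup_opnorm_lty unit setT D N1 N2 (fun=> T) Q1 (fun=> Q2) H1
  (fun _ f _ => H2 f).
rewrite (_ : [set _ | _ in _] = [set opnorm D N1 N2 T]) ?ereal_sup1.
  move=> ->; split=> -[C C0 H]; exists C => // f; first exact: (H tt).
  by move=> g _; exact: H.
by apply/seteqP; split => [x [s _ <-] //|x -> /=]; exists tt.
Qed.

End OperatorNorms.

Section Weights.
Context {R : realType}.
Local Notation mu := (@lebesgue_measure R).
Implicit Types (w f : R -> R) (I : dyadic).

Lemma ae_mono (P Q : R -> Prop) : (forall x, P x -> Q x) ->
  {ae mu, forall x, P x} -> {ae mu, forall x, Q x}.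
Proof.
move=> PQ; apply: negligibleS => x /= nQ; apply: contra_not nQ; exact: PQ.
Qed.

Lemma ae_mono2 (P Q S : R -> Prop) : (forall x, P x -> Q x -> S x) ->
  {ae mu, forall x, P x} -> {ae mu, forall x, Q x} -> {ae mu, forall x, S x}.
Proof.
move=> PQS aP aQ; apply: (negligibleS _ (negligibleU aP aQ)) => x /= nS.
by apply: contrapT => /not_orP[/contrapT p /contrapT q]; apply: nS; exact: PQS.
Qed.

Definition root w : R -> R := fun x => Num.sqrt (w x).

Lemma root_ge0 w x : 0 <= root w x.
Proof. exact: sqrtr_ge0. Qed.

Lemma weight_measurable w : weight w -> measurable_fun setT w.
Proof. by case=> -[]. Qed.

Lemma measurable_root w : measurable_fun setT w -> measurable_fun setT (root w).
Proof.
move=> mw; rewrite (_ : root w = Num.sqrt \o w)//; apply: measurableT_comp => //.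
by apply: continuous_measurable_fun; exact: sqrt_continuous.
Qed.

Lemma root_sqr_le w x : root w x ^+ 2 <= `|w x|.
Proof.
have [w0|w0] := leP 0 (w x); first by rewrite /root sqr_sqrtr// ler_norm.
by rewrite /root ltr0_sqrtr// expr0n normr_ge0.
Qed.

Lemma Rintegral_dset f g I : \int[mu]_(x in dset I) (f x * g x) = coef f g I.
Proof.
rewrite Rintegral_mkcond; apply: eq_Rintegral => x _.
rewrite /restr patchE indicE; case: (_ \in _); first by rewrite mulr1.
by rewrite mulr0 mul0r.
Qed.

Lemma weight_locally_sqint w : weight w -> locally_sqint (root w).
Proof.
move=> [[mw _ wK] _] I.
have mrI : measurable_fun setT (restr (root w) I).
  apply: measurable_funM; first exact: measurable_root.
  by apply: measurable_indic; exact: measurable_dset.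
split=> //.
pose a : R := I.2%:~R * 2 ^ I.1; pose b : R := (I.2 + 1)%:~R * 2 ^ I.1.
apply: le_lt_trans (wK `[a, b]%classic (@subsetT _ _) (@segment_compact _ a b)).
rewrite [leRHS]integral_mkcond; apply: ge0_le_integral => //.
- by move=> x _; rewrite lee_fin sqr_ge0.
- by apply/measurable_EFinP; exact: measurable_funX.
- apply: (iffLR (measurable_restrictT _ (measurable_itv _))).
  by apply/measurable_EFinP; apply: measurable_funTS; exact: measurableT_comp.
- move=> x _; rewrite /restr patchE indicE.
  have [h|h] := pselect (dset I x).
    rewrite mem_set// mulr1 mem_set ?lee_fin ?root_sqr_le//.
    by move: h; rewrite /dset /= !in_itv /= => /andP[-> /ltW ->].
  by rewrite memNset// mulr0 expr0n /=; case: ifP => _; [rewrite lee_fin normr_ge0 | exact: lexx].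
Qed.

Lemma root_sqr_ae w : weight w -> ae_eq mu setT (fun x => root w x ^+ 2) w.
Proof.
move=> [_]; apply: ae_mono => x w0 _.
by rewrite /root sqr_sqrtr// ltW.
Qed.

Lemma weight_mass w I : weight w -> mass (root w) I = len I * avg w I.
Proof.
move=> hw; rewrite /avg mulrA mulfV ?len_neq0// mul1r.
rewrite /mass /nsq (@inner_restr _ _ _ I I)// -/(coef _ _ I) -Rintegral_dset.
rewrite /Rintegral; congr fine.
have mw := weight_measurable hw.
apply: ae_eq_integral; first exact: measurable_dset.
- by apply/measurable_EFinP; apply: measurable_funTS; apply: measurable_funM; exact: measurable_root.
- by apply/measurable_EFinP; exact: measurable_funTS.
- by apply: ae_mono (root_sqr_ae hw) => x /(_ Logic.I) h _; rewrite /= -expr2 h.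
Qed.

(** A null mass would make the root vanish almost everywhere on an interval of positive
length. *)
Lemma weight_mass_gt0 w I : weight w -> 0 < mass (root w) I.
Proof.
move=> hw; rewrite lt_neqAle nsq_ge0 andbT eq_sym; apply/eqP => m0.
have qw := weight_locally_sqint hw I.
have := nsqE qw; rewrite -/(mass _ I) m0 => i0.
have : ae_eq mu setT (fun x => (restr (root w) I x ^+ 2)%:E) (cst 0%E).
  apply/ae_eq_integral_abs => //.
    by apply/measurable_EFinP; apply: measurable_funX; case: qw.
  by rewrite -[RHS]i0; apply: eq_integral => x _; rewrite gee0_abs// lee_fin sqr_ge0.
move=> z; have : {ae mu, forall x, ~ dset I x}.
  case: hw => _; move=> aw; apply: ae_mono2 z aw => x zx wx h.
  have := zx Logic.I; rewrite /restr indicE mem_set// mulr1 => -[] /eqP.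
  by rewrite expf_eq0 /= sqrtr_eq0 leNgt wx.
move=> [N [mN N0 sub]].
have : (mu (dset I) <= mu N)%E.
  apply: le_measure; rewrite ?inE//; first exact: measurable_dset.
  by move=> x h; apply: sub => /= /(_ h).
by rewrite lebesgue_measure_dset N0 lee_fin leNgt len_gt0.
Qed.

End Weights.

(** * The positive operator *)

Section EnumDyadic.
Context {R : realType}.
Implicit Types (u : dyadic -> R) (I : dyadic).

(** Increasing finite sets that exhaust the dyadic intervals, so that unconditional sums
become limits of sequences. *)
Definition enum_dyadic (n : nat) : seq dyadic :=
  pmap (@choice.pickle_inv dyadic) (iota 0 n).

Lemma enum_dyadic_uniq n : uniq (enum_dyadic n).
Proof. by apply: (pmap_uniq (@choice.pickle_invK _)); exact: iota_uniq. Qed.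

Lemma mem_enum_dyadic n I : (choice.pickle I < n)%N -> I \in enum_dyadic n.
Proof.
move=> In; rewrite mem_pmap; apply/mapP; exists (choice.pickle I).
  by rewrite mem_iota.
by rewrite choice.pickleK_inv.
Qed.

Lemma enum_dyadic_mono m n : (m <= n)%N ->
  {subset enum_dyadic m <= enum_dyadic n}.
Proof.
move=> mn I; rewrite /enum_dyadic -(subnKC mn) iotaD pmap_cat mem_cat.
by move=> ->.
Qed.

Lemma enum_dyadic_exhaust (A : seq dyadic) : exists n,
  {subset A <= enum_dyadic n}.
Proof.
exists (\sum_(I <- A) (choice.pickle I).+1)%N => I IA; apply: mem_enum_dyadic.
by rewrite (big_rem I IA) /= addSn ltnS leq_addr.
Qed.

Lemma le_sum_esum (S : set dyadic) u (A : seq dyadic) : uniq A ->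
  (forall I, I \in A -> S I) ->
  ((\sum_(I <- A) u I)%:E <= \esum_(I in S) (u I)%:E)%E.
Proof.
move=> uA AS; apply: esum_ge; exists [set` A].
  by split; [exact: finite_seq | move=> I /= /AS].
by rewrite -fsbig_seq// sumEFin.
Qed.

Lemma esum_le (S : set dyadic) u (M : \bar R) :
  (forall A, uniq A -> (forall I, I \in A -> S I) ->
    ((\sum_(I <- A) u I)%:E <= M)%E) ->
  (\esum_(I in S) (u I)%:E <= M)%E.
Proof.
move=> H; apply: ge_ereal_sup => _ [X [fX XS] <-].
rewrite fsbig_finite//= sumEFin; apply: H; first exact: fset_uniq.
by move=> I; rewrite in_fset_set// inE => /XS.
Qed.

Lemma esum_dyadic_cvg u : (forall I, 0 <= u I) ->
  ((\sum_(I <- enum_dyadic n) u I)%:E @[n --> \oo] -->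
    \esum_(I in [set: dyadic]) (u I)%:E)%E.
Proof.
move=> u0; have -> : (\esum_(I in [set: dyadic]) (u I)%:E)%E =
    ereal_sup (range (fun n => (\sum_(I <- enum_dyadic n) u I)%:E)).
  apply/eqP; rewrite eq_le; apply/andP; split.
    apply: esum_le => A uA _; have [n An] := enum_dyadic_exhaust A.
    apply: (@le_trans _ _ (\sum_(I <- enum_dyadic n) u I)%:E).
      by rewrite lee_fin; exact: ler_sum_uniq_sub.
    by apply: ereal_sup_ubound; exists n.
  apply: ge_ereal_sup => _ [n _ <-]; apply: le_sum_esum => //.
  exact: enum_dyadic_uniq.
apply: ereal_nondecreasing_cvgn => m n mn; rewrite lee_fin.
apply: ler_sum_uniq_sub => //; first exact: enum_dyadic_uniq.
exact: enum_dyadic_mono.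
Qed.

Lemma measurable_esum_dyadic (u : R -> dyadic -> R) : (forall x I, 0 <= u x I) ->
  (forall I, measurable_fun setT (u ^~ I)) ->
  measurable_fun setT (fun x => \esum_(I in [set: dyadic]) (u x I)%:E)%E.
Proof.
move=> u0 mu; apply: (emeasurable_fun_cvg
  (fun n x => (\sum_(I <- enum_dyadic n) u x I)%:E)) => [n|x _].
  by apply/measurable_EFinP; exact: measurable_sum.
exact: esum_dyadic_cvg.
Qed.

End EnumDyadic.

Section PositiveOperator.
Context {R : realType}.
Local Notation mu := (@lebesgue_measure R).
Variables v w : R -> R.
Hypotheses (hv : weight v) (hw : weight w).
Local Notation r := (root w).
Local Notation s := (root v).
Implicit Types (f g : R -> R) (I : dyadic) (A : seq dyadic).

Let qr : locally_sqint r := weight_locally_sqint hw.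
Let qs : locally_sqint s := weight_locally_sqint hv.

Lemma avgE (t : R -> R) I : weight t -> avg t I = mass (root t) I / len I.
Proof. by move=> ht; rewrite weight_mass// mulrC mulKf ?len_neq0. Qed.

Lemma drop_avg (t : R -> R) I : weight t ->
  avg t (left_half I) - avg t (right_half I) = 2 * drop (mass (root t)) I / len I.
Proof.
move=> ht; rewrite !avgE// len_left len_right /drop; field.
exact: len_neq0.
Qed.

(** The factor of the product of indicators of [I] in the kernel of the operator. *)
Definition kernel_coef I : R := (len I)^-1 ^+ 2 * alpha v w I.

Lemma kernel_coef_ge0 I : 0 <= kernel_coef I.
Proof. by rewrite mulr_ge0 ?sqr_ge0// !mulr_ge0// ltW// len_gt0. Qed.

Lemma kernel_coef_diagonal I (a b : R) :
  kernel_coef I * (`|a| * `|b|) = 4 * ((len I)^-1 *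
    (`|a / mass r I * drop (mass r) I| * `|b / mass s I * drop (mass s) I|)).
Proof.
have w0 := weight_mass_gt0 I hw; have v0 := weight_mass_gt0 I hv.
have l0 := len_gt0 I (R := R).
rewrite /kernel_coef /alpha !drop_avg// !avgE//.
have E (d m : R) : 2 * d / len I / (m / len I) = 2 * (d / m).
  have [->|m0] := eqVneq m 0; first by rewrite mul0r invr0 !mulr0.
  by field; rewrite m0 gt_eqF.
rewrite !E !normrM !normfV !(gtr0_norm w0) !(gtr0_norm v0) (gtr0_norm (_ : 0 < 2))//.
by field; rewrite !gt_eqF.
Qed.

Lemma diagonal_formE (a b : dyadic -> R) A :
  4 * diagonal_form (mass r) (mass s) a b A =
  \sum_(I <- A) kernel_coef I * (`|a I| * `|b I|).
Proof.
by rewrite mulr_sumr; apply: eq_bigr => I _; rewrite kernel_coef_diagonal.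
Qed.

Lemma T0_termE f x I : T0_term v w (fun y => r y * f y) x I =
  kernel_coef I * coef r f I * \1_(dset I) x.
Proof.
by rewrite /T0_term /avg Rintegral_dset /kernel_coef; ring.
Qed.

Lemma coef_norm_le (t f : R -> R) I : weight t -> sqint f ->
  `|coef (root t) f I| <= coef (root t) (fun x => `|f x|) I.
Proof.
move=> ht qf; have qt := weight_locally_sqint ht I.
apply: le_trans (normr_inner qt qf) _.
apply: (le_inner (sqint_norm qt) (sqint_norm qf) qt (sqint_norm qf)) => x.
by rewrite ger0_norm// mulr_ge0 ?root_ge0.
Qed.

(** The factor [s] turns norms in [L2(v)] into norms in [L2], where the image can be
paired with functions. *)
Definition T0_part f A : R -> R :=
  fun x => \sum_(I <- A) kernel_coef I * coef r f I * restr s I x.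

Lemma sqint_T0_part f A : sqint (T0_part f A).
Proof. by apply: sqint_sum => I; exact: sqintZ. Qed.

Lemma inner_T0_part f g A : sqint g -> inner (T0_part f A) g =
  \sum_(I <- A) kernel_coef I * (coef r f I * coef s g I).
Proof.
move=> qg; rewrite inner_suml//; last by move=> I; exact: sqintZ.
by apply: eq_bigr => I _; rewrite innerZl// mulrA.
Qed.

Lemma T0_partE f A x :
  T0_part f A x = s x * \sum_(I <- A) T0_term v w (fun y => r y * f y) x I.
Proof.
rewrite mulr_sumr; apply: eq_bigr => I _.
by rewrite T0_termE /restr; ring.
Qed.

Lemma T0_term_ge0 f x I : (forall y, 0 <= f y) -> 
  0 <= T0_term v w (fun y => r y * f y) x I.
Proof.
move=> f0; rewrite T0_termE mulr_ge0// mulr_ge0 ?kernel_coef_ge0//.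
by apply: Rintegral_ge0 => y _; rewrite mulr_ge0// mulr_ge0 ?root_ge0.
Qed.

Lemma measurable_T0_term f I : measurable_fun setT (T0_term v w f ^~ I).
Proof.
apply: measurable_funM => //; apply: measurable_indic; exact: measurable_dset.
Qed.

Lemma measurable_T0 f : measurable_fun setT (T0 v w f).
Proof.
apply: emeasurable_funB; apply: measurable_esum_dyadic => [x I|I].
- by rewrite le_max lexx orbT.
- by apply: measurable_maxr => //; exact: measurable_T0_term.
- by rewrite le_max lexx orbT.
- apply: measurable_maxr => //; apply: measurable_funN; exact: measurable_T0_term.
Qed.

Definition rootT0 f : R -> \bar R :=
  fun x => ((s x)%:E * T0 v w (fun y => r y * f y)%R x)%E.

Lemma T0_part_le f A x : uniq A -> (forall y, 0 <= f y) ->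
  ((T0_part f A x)%:E <= rootT0 f x)%E.
Proof.
move=> uA f0; rewrite T0_partE EFinM /rootT0; apply: lee_wpmul2l.
  by rewrite lee_fin root_ge0.
have t0 I := T0_term_ge0 x I f0.
rewrite /T0 [X in (_ <= _ - X)%E]esum1 ?sube0; last first.
  by move=> I _; rewrite max_r// oppr_le0.
under eq_esum do rewrite max_l//.
exact: le_sum_esum.
Qed.

(** For nonnegative functions every finite part lies below the operator, and pairing it
with the second function gives the diagonal form. *)
Lemma T0_diagonal_bounded (M : R) : 0 < M ->
  (forall f, sqint f ->
    (\int[mu]_x (rootT0 f x * rootT0 f x) <= M%:E * (nsq f)%:E)%E) ->
  diagonal_bounded r s.
Proof.
move=> M0 H; exists (M + 1) => [|f g A qf qg uA]; first by lra.
set f' := fun x => `|f x|; set g' := fun x => `|g x|.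
have qf' : sqint f' := sqint_norm qf; have qg' : sqint g' := sqint_norm qg.
have f'0 y : 0 <= f' y by exact: normr_ge0.
set Q := T0_part f' A; have qQ : sqint Q by exact: sqint_T0_part.
have Q0 x : 0 <= Q x.
  rewrite /Q T0_partE mulr_ge0 ?root_ge0//; apply: sumr_ge0 => I _.
  exact: T0_term_ge0.
have nQ : nsq Q <= M * nsq f.
  rewrite -lee_fin -nsqE//; move: (H f' qf'); rewrite nsq_norm EFinM; apply: le_trans.
  have QT x : ((Q x)%:E <= rootT0 f' x)%E by exact: T0_part_le.
  have mT : measurable_fun setT (rootT0 f').
    apply: emeasurable_funM; last exact: measurable_T0.
    by apply/measurable_EFinP; apply: measurable_root; exact: weight_measurable.
  apply: ge0_le_integral => //.
  - by move=> x _; rewrite lee_fin sqr_ge0.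
  - by apply/measurable_EFinP; apply: measurable_funX; case: qQ.
  - exact: emeasurable_funM.
  - by move=> x _; rewrite expr2 EFinM; apply: lee_pmul; rewrite ?lee_fin.
have D : 4 * diagonal_form (mass r) (mass s) (coef r f) (coef s g) A <= inner Q g'.
  rewrite inner_T0_part// diagonal_formE; apply: ler_sum => I _.
  rewrite ler_wpM2l ?kernel_coef_ge0//.
  by apply: ler_pM => //; exact: coef_norm_le.
have := inner_le_nsq qQ qg'; rewrite (nsq_norm g).
have f0 := nsq_ge0 f; have g0 := nsq_ge0 g; have := mulr_ge0 (ltW M0) g0.
have := mulr_ge0 (ltW M0) f0; lra.
Qed.

(** Absolute values inside the averages dominate the positive and the negative parts
together, also where both are infinite. *)
Lemma abse_rootT0_le f x : sqint f -> (`|rootT0 f x| <=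
  (s x)%:E * \esum_(I in [set: dyadic])
    (T0_term v w (fun y => r y * `|f y|)%R x I)%:E)%E.
Proof.
move=> qf; rewrite /rootT0 abseM gee0_abs ?lee_fin ?root_ge0//.
apply: lee_wpmul2l; first by rewrite lee_fin root_ge0.
apply: le_trans (lee_abs_sub _ _) _.
have p0 (y : R) : (0 <= (Num.max y 0)%:E)%E by rewrite lee_fin le_max lexx orbT.
rewrite !gee0_abs; [|by apply: esum_ge0|by apply: esum_ge0].
rewrite -esumD; [|by []|by []].
apply: le_esum => I _; rewrite -EFinD lee_fin !T0_termE.
have i0 : 0 <= \1_(dset I) x :> R by [].
have -> : forall y : R, Num.max y 0 + Num.max (- y) 0 = `|y|.
  move=> y; have /orP[y0|y0] := le_total 0 y.
    have y1 : - y <= 0 by rewrite oppr_le0.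
    by rewrite (max_l y0) (max_r y1) addr0 ger0_norm.
  have y1 : 0 <= - y by rewrite oppr_ge0.
  by rewrite (max_r y0) (max_l y1) add0r ler0_norm.
rewrite normrM (ger0_norm i0) normrM (ger0_norm (kernel_coef_ge0 I)).
by rewrite ler_wpM2r// ler_wpM2l ?kernel_coef_ge0// coef_norm_le.
Qed.

(** Each finite part is bounded by duality with itself; monotone convergence then gives
the full operator on nonnegative functions, which dominates it on all functions. *)
Lemma diagonal_bounded_T0 : diagonal_bounded r s ->
  exists2 M : R, 0 < M & forall f, sqint f ->
    (\int[mu]_x (rootT0 f x * rootT0 f x) <= M%:E * (nsq f)%:E)%E.
Proof.
move=> [C C0 H]; exists (4 * (4 * C) ^+ 2) => [|f qf].
  by rewrite mulr_gt0// exprn_gt0// mulr_gt0.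
set f' := fun x => `|f x|; have qf' : sqint f' := sqint_norm qf.
have f'0 y : 0 <= f' y by exact: normr_ge0.
have part A : uniq A -> nsq (T0_part f' A) <= 4 * (4 * C) ^+ 2 * nsq f.
  move=> uA; set Q := T0_part f' A; have qQ : sqint Q by exact: sqint_T0_part.
  apply: scaling_bound => [|t t0]; first by rewrite mulr_gt0.
  rewrite -(nsq_norm f) -/f' -mulrA -(nsqZ _ qQ).
  have qtQ : sqint (fun x => t * Q x) by exact: sqintZ.
  have h := ler_wpM2l (_ : 0 <= 4 :> R) (H f' _ A qf' qtQ uA).
  rewrite diagonal_formE in h; apply: le_trans (h _) => //.
  rewrite /nsq -innerZr// inner_T0_part//; apply: ler_sum => I _.
  rewrite ler_wpM2l ?kernel_coef_ge0//.
  by rewrite -normrM ler_norm.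
pose E x : \bar R := (\esum_(I in [set: dyadic]) (T0_term v w (fun y => r y * f' y)%R x I)%:E)%E.
have t0 x I : 0 <= T0_term v w (fun y => r y * f' y) x I by exact: T0_term_ge0.
pose G n x : \bar R := (T0_part f' (enum_dyadic n) x ^+ 2)%:E.
have S0 n x : 0 <= \sum_(I <- enum_dyadic n) T0_term v w (fun y => r y * f' y) x I.
  exact: sumr_ge0.
have GE x : (G n x @[n --> \oo] --> ((s x)%:E * E x) * ((s x)%:E * E x))%E.
  have c : (((T0_part f' (enum_dyadic n) x)%:E) @[n --> \oo] --> (s x)%:E * E x)%E.
    under eq_fun do rewrite T0_partE EFinM.
    by apply: cvgeZl => //; exact: esum_dyadic_cvg.
  under eq_fun do rewrite /G expr2 EFinM.
  apply: (cvgeM _ c c); rewrite mule_defE orbb.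
  by have [->|//] := eqVneq ((s x)%:E * E x)%E 0%E; rewrite abse0.
have G0 n x : (0 <= G n x)%E by rewrite lee_fin sqr_ge0.
have mG n : measurable_fun setT (G n).
  by apply/measurable_EFinP; apply: measurable_funX; case: (sqint_T0_part f' (enum_dyadic n)).
have ndG x : {homo G ^~ x : m n / (m <= n)%N >-> (m <= n)%E}.
  move=> m n mn; rewrite lee_fin lerXn2r ?nnegrE ?T0_partE ?mulr_ge0 ?root_ge0//.
  rewrite ler_wpM2l ?root_ge0//; apply: ler_sum_uniq_sub => //.
    exact: enum_dyadic_uniq.
  exact: enum_dyadic_mono.
have mrT : measurable_fun setT (rootT0 f).
  apply: emeasurable_funM; last exact: measurable_T0.
  by apply/measurable_EFinP; apply: measurable_root; exact: weight_measurable.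
apply: (@le_trans _ _ (\int[mu]_x limn (G ^~ x))%E).
  apply: ge0_le_integral => //.
  - by move=> x _; rewrite -abse_expe2 sqre_ge0.
  - exact: emeasurable_funM.
  - apply: (emeasurable_fun_cvg G) => // x _.
    by apply: cvgP (GE x).
  - move=> x _; rewrite (cvg_lim _ (GE x))//.
    rewrite -abse_expe2 expe2; apply: lee_pmul => //; exact: abse_rootT0_le.
rewrite monotone_convergence//.
apply: lime_le.
  apply: ereal_nondecreasing_is_cvgn => m n mn.
  apply: ge0_le_integral; [by []|by move=> x _; exact: G0|exact: mG|exact: mG|].
  by move=> x _; exact: ndG.
apply: nearW => n; rewrite nsqE ?lee_fin; last exact: sqint_T0_part.
by apply: part; exact: enum_dyadic_uniq.
Qed.

End PositiveOperator.

(** * Limits and density in L2 *)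

Section Completeness.
Context {R : realType}.
Local Notation mu := (@lebesgue_measure R).
Implicit Types (f g F : R -> R).

Lemma limn_esup_between (a b : R) (u : nat -> R) N :
  (forall m, (N <= m)%N -> a <= u m <= b) ->
  (a%:E <= limn_esup (EFin \o u) <= b%:E)%E.
Proof.
move=> ab; rewrite limn_esup_lim; apply/andP; split.
  apply: lime_ge; first exact: is_cvg_esups.
  exists N => // m /= Nm; apply: (@le_trans _ _ (u m)%:E).
    by rewrite lee_fin; case/andP: (ab m Nm).
  by apply: ereal_sup_ubound; exists m => /=.
apply: lime_le; first exact: is_cvg_esups.
exists N => // m /= Nm; apply: ge_ereal_sup => _ [k /= mk <-].
by rewrite /= lee_fin; case/andP: (ab k (leq_trans Nm mk)).
Qed.

Lemma sum_half_le (m : nat) : \sum_(k < m) (2^-1 : R) ^+ k <= 2.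
Proof.
suff : \sum_(k < m) (2^-1 : R) ^+ k = 2 - 2 * 2^-1 ^+ m.
  by move=> ->; rewrite gerBl mulr_ge0// exprn_ge0.
elim: m => [|m ih]; first by rewrite big_ord0 expr0; ring.
by rewrite big_ord_recr /= ih exprS; field.
Qed.

(** Iterates [(a + b) ^ 2 <= 2 a ^ 2 + 2 b ^ 2]; the weights absorb the doubling at each
step. *)
Lemma telescope_sqr_le (u : nat -> R) n j :
  (u (n + j)%N - u n) ^+ 2 <=
  2 * 2^-1 ^+ n * \sum_(n <= k < n + j) 2 ^+ k * (u k.+1 - u k) ^+ 2.
Proof.
elim: j n => [|j ih] n.
  by rewrite addn0 subrr expr0n /= big_geq// mulr0.
rewrite big_ltn; last by rewrite addnS ltnS leq_addr.
have := ih n.+1; rewrite addSnnS; set S := \sum_(_ <= _ < _) _ => h.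
have E : 2^-1 ^+ n * 2 ^+ n = 1 :> R by rewrite -exprMn mulVf// expr1n.
rewrite mulrDr (_ : _ * (2 ^+ n * _) =
  2 * (2^-1 ^+ n * 2 ^+ n) * (u n.+1 - u n) ^+ 2); last by ring.
rewrite E mulr1.
rewrite (_ : 2 * 2^-1 ^+ n.+1 * S = 2^-1 ^+ n * S) in h; last first.
  by rewrite exprS; field.
have : (u (n + j.+1)%N - u n) ^+ 2 <=
    2 * (u n.+1 - u n) ^+ 2 + 2 * (u (n + j.+1)%N - u n.+1) ^+ 2.
  have := sqr_ge0 ((u n.+1 - u n) - (u (n + j.+1)%N - u n.+1)); lra.
lra.
Qed.

(** The upper limit serves as the
limit function because it is measurable, and the geometrically weighted sum [D] of
the squared increments dominates its distance to the sequence at every point. *)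
Lemma L2_fast_limit (u : nat -> R -> R) : (forall n, sqint (u n)) ->
  (forall n, nsq (fun x => u n.+1 x - u n x) <= (4^-1 : R) ^+ n) ->
  exists2 F : R -> R, measurable_fun setT F & forall n,
    (\int[mu]_x ((F x - u n x) ^+ 2)%:E <= (4 * 2^-1 ^+ n)%:E)%E.
Proof.
move=> qu du; pose F x := fine (limn_esup (fun n => (u n x)%:E)).
have mF : measurable_fun setT F.
  apply: (measurableT_comp (fine_measurable _)) => //.
  apply: (measurable_fun_limn_esup (f := fun n x => (u n x)%:E)) => n.
  by apply/measurable_EFinP; case: (qu n).
exists F => // n.
pose d k x : \bar R := (2 ^+ k * (u k.+1 x - u k x) ^+ 2)%:E.
have d0 k x : (0 <= d k x)%E.
  by rewrite lee_fin; apply: mulr_ge0; [exact: exprn_ge0 | exact: sqr_ge0].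
have md k : measurable_fun setT (d k).
  apply/measurable_EFinP; apply: measurable_funM => //; apply: measurable_funX.
  by apply: measurable_funB; [case: (qu k.+1) | case: (qu k)].
pose D x := (\sum_(0 <= k <oo) d k x)%E.
have mD : measurable_fun setT D.
  by apply: (ge0_emeasurable_sum (h := d) (P := xpredT)) => // k _ x _.
have D0 x : (0 <= D x)%E by apply: nneseries_ge0.
have iD : (\int[mu]_x D x <= 2%:E)%E.
  rewrite integral_nneseries//; apply: lime_le.
    by apply: is_cvg_nneseries => k _ _; exact: integral_ge0.
  apply: nearW => m; apply: (@le_trans _ _ (\sum_(k < m) (2^-1 ^+ k)%:E)%E).
    rewrite big_mkord; apply: lee_sum => k _.
    have qk : sqint (fun x => u k.+1 x - u k x) by exact: sqintB.
    under eq_integral do rewrite /d EFinM.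
    rewrite ge0_integralZl_EFin//; last first.
    - by apply/measurable_EFinP; apply: measurable_funX; case: qk.
    - by move=> x _; rewrite lee_fin sqr_ge0.
    rewrite nsqE// -EFinM lee_fin.
    apply: (@le_trans _ _ (2 ^+ k * 4^-1 ^+ k)); first by rewrite ler_wpM2l// exprn_ge0.
    by rewrite -exprMn (_ : 2 * 4^-1 = 2^-1)//; field.
  by rewrite sumEFin lee_fin; exact: sum_half_le.
have FD x : (((F x - u n x) ^+ 2)%:E <= (2 * 2^-1 ^+ n)%:E * D x)%E.
  have c0 : 0 < 2 * 2^-1 ^+ n :> R by rewrite mulr_gt0// exprn_gt0// invr_gt0.
  have [DE|/eqP Dy] := eqVneq (D x) +oo%E; first by rewrite DE gt0_muley ?leey// lte_fin.
  have [z zE] : exists z, D x = z%:E.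
    by move: (D0 x) Dy; case: (D x) => // z _ _; exists z.
  rewrite zE -EFinM lee_fin; set S := 2 * 2^-1 ^+ n * z.
  have uS m : (n <= m)%N -> (u m x - u n x) ^+ 2 <= S.
    move=> nm; rewrite -(subnKC nm); apply: (le_trans (telescope_sqr_le (u ^~ x) _ _)).
    rewrite ler_wpM2l ?(ltW c0)// subnKC// -lee_fin -zE.
    apply: (@le_trans _ _ (\sum_(0 <= k < m) d k x)%E); last first.
      exact: (nneseries_lim_ge m (P := xpredT)).
    rewrite (@big_cat_nat _ _ _ n 0 m)//= -sumEFin leeDr//.
    exact: sume_ge0.
  have S0 : 0 <= S by apply: le_trans (uS n (leqnn n)); exact: sqr_ge0.
  have uE m : (n <= m)%N -> u n x - Num.sqrt S <= u m x <= u n x + Num.sqrt S.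
    move=> nm; have := uS m nm; rewrite -[leLHS]real_normK ?num_real//.
    rewrite -[X in _ <= X](sqr_sqrtr S0) ler_sqr ?nnegrE ?sqrtr_ge0//.
    by rewrite ler_norml lerBlDl lerBrDl => /andP[h1 h2]; apply/andP; split; lra.
  have /andP[l1 l2] := limn_esup_between uE.
  have : `|F x - u n x| <= Num.sqrt S.
    rewrite /F; move: l1 l2; rewrite /comp; case: (limn_esup _) => [y| |]//=.
    by rewrite !lee_fin => l1 l2; rewrite ler_norml; apply/andP; split; lra.
  move=> h; rewrite -(real_normK (num_real (F x - u n x))) -[leRHS](sqr_sqrtr S0).
  by rewrite ler_sqr ?nnegrE ?sqrtr_ge0.
apply: (@le_trans _ _ (\int[mu]_x ((2 * 2^-1 ^+ n)%:E * D x))%E).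
  apply: ge0_le_integral.
  - by [].
  - by move=> x _; rewrite lee_fin sqr_ge0.
  - apply/measurable_EFinP; apply: measurable_funX; apply: measurable_funB => //.
    by case: (qu n).
  - exact: measurable_funeM.
  - by move=> x _; exact: FD.
have c0 : 0 <= 2 * 2^-1 ^+ n :> R by rewrite mulr_ge0// exprn_ge0.
rewrite ge0_integralZl_EFin//.
apply: (@le_trans _ _ ((2 * 2^-1 ^+ n)%:E * 2%:E)%E); first exact: lee_wpmul2l.
by rewrite -EFinM lee_fin le_eqVlt; apply/orP; left; apply/eqP; ring.
Qed.

(** Monotone convergence along an exhaustion. *)
Lemma integral_sqr_exhaust F (E : nat -> set R) (M : \bar R) :
  measurable_fun setT F -> (forall n, measurable (E n)) ->
  (forall m n, (m <= n)%N -> E m `<=` E n) -> (forall x, exists n, E n x) ->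
  (forall n, (\int[mu]_x ((F x * \1_(E n) x) ^+ 2)%:E <= M)%E) ->
  (\int[mu]_x (F x ^+ 2)%:E <= M)%E.
Proof.
move=> mF mE ndE cE H.
pose g n x : \bar R := ((F x * \1_(E n) x) ^+ 2)%:E.
have gE x : limn (g ^~ x) = (F x ^+ 2)%:E.
  have [N EN] := cE x; apply: lim_near_cst => //.
  exists N => // n /= Nn; rewrite /g indicE mem_set ?mulr1//.
  exact: ndE EN.
under eq_integral do rewrite -gE.
have g0 n x : (0 <= g n x)%E by rewrite lee_fin sqr_ge0.
have mg n : measurable_fun setT (g n).
  apply/measurable_EFinP; apply: measurable_funX; apply: measurable_funM => //.
have ndg x : {homo g ^~ x : m n / (m <= n)%N >-> (m <= n)%E}.
  move=> m n mn; rewrite lee_fin !exprMn ler_wpM2l ?sqr_ge0//.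
  rewrite lerXn2r ?nnegrE// !indicE.
  have [h|h] := pselect (E m x); last by rewrite (memNset h).
  by rewrite (mem_set h) (mem_set (ndE _ _ mn _ h)).
rewrite monotone_convergence//; apply: lime_le; last by apply: nearW => n; exact: H.
apply: ereal_nondecreasing_is_cvgn => m n mn.
apply: ge0_le_integral; [by []|by move=> x _; exact: g0|exact: mg|exact: mg|].
by move=> x _; exact: ndg.
Qed.

Lemma sqr_le_sqint F (M : R) : measurable_fun setT F ->
  (\int[mu]_x (F x ^+ 2)%:E <= M%:E)%E -> sqint F /\ nsq F <= M.
Proof.
move=> mF FM; have qF : sqint F by split=> //; apply: le_lt_trans FM _; exact: ltry.
by split=> //; rewrite -lee_fin -nsqE.
Qed.

(** Both the variable and the function are cut off, so that the truncation of any
measurable function is a bounded function with compact support. *)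
Definition truncation_set f (n : nat) : set R :=
  [set x | `|x| <= n%:R] `&` [set x | `|f x| <= n%:R].

Lemma measurable_truncation_set f n : measurable_fun setT f ->
  measurable (truncation_set f n).
Proof.
move=> mf; apply: measurableI.
  rewrite (_ : [set x | _] = `[- n%:R, n%:R]%classic); first exact: measurable_itv.
  by apply/seteqP; split => x; rewrite /= in_itv /= ler_norml.
rewrite (_ : [set x | _] = f @^-1` `[- n%:R, n%:R]%classic).
  by rewrite -[X in measurable X]setTI; apply: mf => //; exact: measurable_itv.
by apply/seteqP; split => x; rewrite /= in_itv /= ler_norml.
Qed.

Lemma truncation_set_mono f m n : (m <= n)%N ->
  truncation_set f m `<=` truncation_set f n.
Proof.
by move=> mn x [h1 h2]; split; [apply: le_trans h1 _ | apply: le_trans h2 _];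
  rewrite ler_nat.
Qed.

Lemma truncation_set_cover f x : exists n, truncation_set f n x.
Proof.
exists (Num.truncn (`|x| + `|f x|)).+1.
have h := truncnS_gt (`|x| + `|f x|).
by split; apply: ltW; apply: le_lt_trans h; rewrite ?lerDl ?lerDr.
Qed.

Lemma truncation_bcs f n : measurable_fun setT f ->
  bounded_compactly_supported (fun x => f x * \1_(truncation_set f n) x).
Proof.
move=> mf; split.
- apply: measurable_funM => //; apply: measurable_indic.
  exact: measurable_truncation_set.
- exists n%:R => x; rewrite indicE.
  have [h|h] := pselect (truncation_set f n x).
    by rewrite mem_set// mulr1; case: h.
  by rewrite memNset// mulr0 normr0.
- exists `[- n%:R, n%:R]%classic; first exact: segment_compact.
  move=> x nx; rewrite indicE memNset ?mulr0//.
  by move=> [h _]; apply: nx; rewrite /= in_itv /= -ler_norml.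
Qed.

Lemma bcs_sqint f : bounded_compactly_supported f -> sqint f.
Proof.
move=> [mf [M fM] [K cK fK]]; split=> //.
have mK : measurable K by exact: compact_measurable.
apply: (@le_lt_trans _ _ (\int[mu]_x ((M ^+ 2)%:E * (\1_K x)%:E))%E).
  apply: ge0_le_integral => //.
  - by move=> x _; rewrite lee_fin sqr_ge0.
  - by apply/measurable_EFinP; exact: measurable_funX.
  - by apply/measurable_EFinP; apply: measurable_funM.
  - move=> x _; rewrite -EFinM lee_fin indicE.
    have [h|h] := pselect (K x); last by rewrite memNset// mulr0 fK// expr0n.
    rewrite mem_set// mulr1 -(real_normK (num_real (f x))) lerXn2r ?nnegrE//.
    exact: le_trans (fM x).
rewrite ge0_integralZl_EFin ?sqr_ge0//; last by apply/measurable_EFinP.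
rewrite integral_indic// setIT lte_mul_pinfty ?lee_fin ?sqr_ge0//.
exact: compact_finite_measure.
Qed.

(** The truncations are orthogonal to the remainders, so that convergence of their
norms suffices. *)
Lemma bcs_dense f (e : R) : sqint f -> 0 < e ->
  exists h, [/\ bounded_compactly_supported h, nsq h <= nsq f &
    nsq (fun x => f x - h x) <= e].
Proof.
move=> qf e0; have mf := sqint_measurable qf.
pose h n x := f x * \1_(truncation_set f n) x.
have qh n : sqint (h n) by apply: bcs_sqint; exact: truncation_bcs.
have [n hn] : exists n, nsq f - e < nsq (h n).
  apply: contrapT => /forallNP H.
  have : (\int[mu]_x (f x ^+ 2)%:E <= (nsq f - e)%:E)%E.
    apply: (integral_sqr_exhaust (E := truncation_set f)) => //.
    - by move=> n; exact: measurable_truncation_set.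
    - exact: truncation_set_mono.
    - exact: truncation_set_cover.
    - by move=> n; rewrite (nsqE (qh n)) lee_fin leNgt; apply/negP/H.
  by rewrite nsqE// lee_fin; lra.
exists (h n); split; first exact: truncation_bcs.
- apply: le_nsq => // x; rewrite /h normrM ler_piMr// indicE.
  by case: (_ \in _); rewrite ?normr1 ?normr0.
- have qd : sqint (fun x => f x - h n x) by exact: sqintB.
  have E : nsq f = nsq (h n) + nsq (fun x => f x - h n x).
    have := nsqD (qh n) qd; rewrite (_ : inner _ _ = 0).
      rewrite mulr0 addr0 => <-; congr nsq; apply/funext => x; ring.
    rewrite -(inner0l (fun=> 0)); apply: eq_Rintegral => x _; rewrite /h mul0r indicE.
    by case: (_ \in _); rewrite ?mulr1 ?subrr ?mulr0 ?mul0r.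
  lra.
Qed.

End Completeness.

(** * Haar series and Haar multipliers *)

Section HaarSeries.
Context {R : realType}.
Local Notation mu := (@lebesgue_measure R).
Implicit Types (f g F : R -> R) (I : dyadic) (A B : seq dyadic) (c sigma : dyadic -> R).

Let one : R -> R := fun=> 1.

Lemma weighted_haar1 I : weighted_haar one I = haar I.
Proof. by apply/funext => x; rewrite /weighted_haar mul1r. Qed.

Lemma integral_restr1 I : (\int[mu]_x (restr one I x ^+ 2)%:E = (len I)%:E)%E.
Proof.
rewrite -lebesgue_measure_dset -(setIT (dset I)) -integral_indic//; last first.
  exact: measurable_dset.
by apply: eq_integral => x _; rewrite /restr mul1r expr2 indic_sub// setIT.
Qed.

Lemma locally_sqint1 : locally_sqint one.
Proof.
move=> I; split; last by rewrite integral_restr1 ltry.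
apply: measurable_funM; first exact: measurable_cst.
by apply: measurable_indic; exact: measurable_dset.
Qed.

Lemma mass1 I : mass one I = len I.
Proof.
by apply: EFin_inj; rewrite -integral_restr1 nsqE//; exact: locally_sqint1.
Qed.

Lemma sqint_haar I : sqint (haar I : R -> R).
Proof. by rewrite -weighted_haar1; apply: sqint_weighted_haar; exact: locally_sqint1. Qed.

(** For the constant weight the energy is the square of the Haar coefficient; the
factor 2 is inherited from [potential_sum]. *)
Lemma haar_bessel g A : sqint g -> uniq A ->
  \sum_(I <- A) inner (haar I) g ^+ 2 <= 2 * nsq g.
Proof.
move=> qg uA; have q1 := locally_sqint1.
have m0 I : 0 < mass one I by rewrite mass1 len_gt0.
have := @haar_energy_sum _ (nsq g) (mass one) (coef one g) (mass g) A uA m0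
  (mass_additive q1) (coef_additive q1 qg)
  (mass_additive (fun I => sqint_restr I qg)) (fun I => coef_sqr_le I q1 qg)
  (fun I => mass_le I qg).
apply: le_trans; apply: ler_sum => I _.
rewrite -weighted_haar1 inner_weighted_haar// exprMn [X in X * _]expr2 sqrt_len_mul.
rewrite /haar_energy /drop !mass1 len_left len_right le_eqVlt; apply/orP; left; apply/eqP.
by field; exact: len_neq0.
Qed.

Definition haar_poly c A : R -> R := fun x => \sum_(I <- A) c I * haar I x.

Lemma sqint_haar_poly c A : sqint (haar_poly c A).
Proof. by apply: sqint_sum => I; apply: sqintZ; exact: sqint_haar. Qed.

(** Pairs the polynomial with itself and applies Bessel to the second factor. *)
Lemma nsq_haar_poly_le c A : uniq A ->
  nsq (haar_poly c A) <= 2 * \sum_(I <- A) c I ^+ 2.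
Proof.
move=> uA; set P := haar_poly c A; have qP : sqint P := sqint_haar_poly c A.
have E : nsq P = \sum_(I <- A) c I * inner (haar I) P.
  rewrite {1}/nsq {1}/P inner_suml//.
    by apply: eq_bigr => I _; rewrite innerZl//; exact: sqint_haar.
  by move=> I; apply: sqintZ; exact: sqint_haar.
have : nsq P <= \sum_(I <- A) c I ^+ 2 + 4^-1 * \sum_(I <- A) inner (haar I) P ^+ 2.
  rewrite {1}E mulr_sumr -big_split /=; apply: ler_sum => I _.
  by have := sqr_ge0 (c I - 2^-1 * inner (haar I) P); lra.
by have := haar_bessel qP uA; lra.
Qed.

Lemma big_sub_filter (A B : seq dyadic) (h : dyadic -> R) : uniq A -> uniq B ->
  \sum_(I <- A) h I - \sum_(I <- B) h I =
  \sum_(I <- [seq I <- A | I \notin B]) h I - \sum_(I <- [seq I <- B | I \notin A]) h I.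
Proof.
move=> uA uB; rewrite (bigID (mem B)) [X in _ - X](bigID (mem A)) /= !big_filter.
rewrite -(big_filter A (mem B)) -(big_filter B (mem A)).
rewrite (@perm_big _ _ _ _ [seq I <- A | mem B I] [seq I <- B | mem A I]).
  by rewrite opprD addrACA subrr add0r.
apply: uniq_perm; rewrite ?filter_uniq// => I.
by rewrite !mem_filter andbC.
Qed.

Lemma nsq_haar_poly_sub_le c A B (e1 e2 : R) : uniq A -> uniq B ->
  \sum_(I <- [seq I <- A | I \notin B]) c I ^+ 2 <= e1 ->
  \sum_(I <- [seq I <- B | I \notin A]) c I ^+ 2 <= e2 ->
  nsq (fun x => haar_poly c A x - haar_poly c B x) <= 4 * e1 + 4 * e2.
Proof.
move=> uA uB h1 h2.
rewrite (_ : (fun x => _) = fun x => haar_poly c [seq I <- A | I \notin B] x +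
    (-1) * haar_poly c [seq I <- B | I \notin A] x); last first.
  by apply/funext => x; rewrite mulN1r; exact: big_sub_filter.
apply: (le_trans (nsqD_le (sqint_haar_poly _ _) (sqintZ _ (sqint_haar_poly _ _)))).
rewrite nsqZ; last exact: sqint_haar_poly.
have := nsq_haar_poly_le c (filter_uniq (fun I => I \notin B) uA).
have := nsq_haar_poly_le c (filter_uniq (fun I => I \notin A) uB).
lra.
Qed.

Lemma square_summable_tail c (M : R) :
  (forall A, uniq A -> \sum_(I <- A) c I ^+ 2 <= M) ->
  forall e, 0 < e -> exists2 A, uniq A & forall B, uniq B ->
    (forall I, I \in B -> I \notin A) -> \sum_(I <- B) c I ^+ 2 <= e.
Proof.
move=> cM e e0; pose S := [set \sum_(I <- A) c I ^+ 2 | A in [set A | uniq A]].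
have hS : has_sup S.
  split; first by exists (\sum_(I <- [::]) c I ^+ 2); exists [::].
  by exists M => _ [A uA <-]; exact: cM.
have [_ [A uA <-] hA] := sup_adherent e0 hS; exists A => // B uB BA.
have : \sum_(I <- A ++ B) c I ^+ 2 <= sup S.
  apply: ub_le_sup; first by case: hS.
  exists (A ++ B) => //=; rewrite cat_uniq uA uB andbT /=.
  by apply/hasPn => I /BA.
by rewrite big_cat /=; lra.
Qed.

(** Riesz-Fischer for the Haar system. *)
Lemma haar_series_converges c (M : R) :
  (forall A, uniq A -> \sum_(I <- A) c I ^+ 2 <= M) ->
  exists2 F : R -> R, measurable_fun setT F & forall e, 0 < e ->
    exists2 A, uniq A & forall B, uniq B -> {subset A <= B} ->
      sqint (fun x => haar_poly c B x - F x) /\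
      nsq (fun x => haar_poly c B x - F x) < e.
Proof.
move=> cM; (* the factor absorbs the constants of [nsq_haar_poly_sub_le] *)
pose e_ n : R := 8^-1 * 4^-1 ^+ n.
have e_0 n : 0 < e_ n by rewrite mulr_gt0// exprn_gt0.
have /choice[A_ HA] : forall n, exists A, uniq A /\ forall B, uniq B ->
    (forall I, I \in B -> I \notin A) -> \sum_(I <- B) c I ^+ 2 <= e_ n.
  by move=> n; have [A uA H] := square_summable_tail cM (e_0 n); exists A.
have uA n : uniq (A_ n) by case: (HA n).
have tail n B : uniq B -> \sum_(I <- [seq I <- B | I \notin A_ n]) c I ^+ 2 <= e_ n.
  move=> uB; case: (HA n) => _; apply; first exact: filter_uniq.
  by move=> I; rewrite mem_filter => /andP[].
have [|F mF FA] := @L2_fast_limit R (fun n => haar_poly c (A_ n))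
    (fun n => sqint_haar_poly c (A_ n)).
  move=> n; apply: (le_trans (nsq_haar_poly_sub_le (uA _) (uA _) (tail _ _ (uA _))
    (tail _ _ (uA _)))).
  rewrite /e_ exprS; have : 0 < (4^-1 : R) ^+ n by rewrite exprn_gt0.
  by set p := _ ^+ n; lra.
exists F => // e e0.
have [n ne] : exists n : nat, 9 * 2^-1 ^+ n < e.
  exists (Num.truncn (9 / e)).+1; rewrite exprVn ltr_pdivrMr ?exprn_gt0//.
  rewrite mulrC -ltr_pdivrMr//; apply: (lt_trans (truncnS_gt _)).
  by rewrite -natrX ltr_nat ltn_expl.
exists (A_ n) => // B uB AB.
have [qd nd] := sqr_le_sqint (F := fun x => F x - haar_poly c (A_ n) x)
  (measurable_funB mF (sqint_measurable (sqint_haar_poly c (A_ n)))) (FA n).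
have qB : sqint (fun x => haar_poly c B x - haar_poly c (A_ n) x).
  by apply: sqintB; exact: sqint_haar_poly.
have E : (fun x => haar_poly c B x - F x) = fun x =>
    (haar_poly c B x - haar_poly c (A_ n) x) + (-1) * (F x - haar_poly c (A_ n) x).
  by apply/funext => x; ring.
rewrite E; split; first by apply: sqintD => //; exact: sqintZ.
apply: (le_lt_trans (nsqD_le qB (sqintZ _ qd))); rewrite nsqZ//.
have t0 : \sum_(I <- [seq I <- A_ n | I \notin B]) c I ^+ 2 <= 0.
  rewrite big_filter big1_seq// => I /andP[IB IA].
  by rewrite AB in IB.
have h := nsq_haar_poly_sub_le uB (uA n) (tail n B uB) t0.
have e2 : e_ n <= 8^-1 * 2^-1 ^+ n.
  rewrite ler_wpM2l// lerXn2r ?nnegrE ?invr_ge0//; lra.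
lra.
Qed.

Lemma L2norm_lt F (e : R) : measurable_fun setT F -> 0 < e ->
  (L2norm (fun x => (F x)%:E) < e%:E)%E <-> sqint F /\ nsq F < e ^+ 2.
Proof.
move=> mF e0; rewrite L2normE.
have -> : (\int[mu]_x ((F x)%:E * (F x)%:E) = \int[mu]_x (F x ^+ 2)%:E)%E.
  by apply: eq_integral => x _; rewrite expr2 EFinM.
have i0 : (0 <= \int[mu]_x (F x ^+ 2)%:E)%E.
  by apply: integral_ge0 => x _; rewrite lee_fin sqr_ge0.
have E : sqint F -> ((\int[mu]_x (F x ^+ 2)%:E) `^ 2^-1 < e%:E)%E = (nsq F < e ^+ 2).
  move=> qF; rewrite nsqE// poweR12_sqrt ?lee_fin ?nsq_ge0//= lte_fin.
  by rewrite -[e in LHS](gtr0_norm e0) -sqrtr_sqr ltr_sqrt// exprn_gt0.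
split=> [h|[qF nF]]; last by rewrite E.
have qF : sqint F.
  split=> //; rewrite -poweR_half_lty//; apply: lt_trans h _; exact: ltry.
by rewrite E in h.
Qed.

Lemma haar_sumP sigma g F : haar_sum sigma g F <->
  measurable_fun setT F /\ forall e : R, 0 < e -> exists A0 : {fset dyadic},
    forall A : {fset dyadic}, (A0 `<=` A)%fset ->
      sqint (fun x => haar_psum sigma g A x - F x) /\
      nsq (fun x => haar_psum sigma g A x - F x) < e.
Proof.
have mP (A : {fset dyadic}) : measurable_fun setT (haar_psum sigma g A).
  exact: sqint_measurable (sqint_haar_poly _ A).
split=> -[mF H]; split=> // e e0.
  have s0 : 0 < Num.sqrt e by rewrite sqrtr_gt0.
  have [A0 HA] := H _ s0; exists A0 => A /HA/L2norm_lt.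
  rewrite sqr_sqrtr; last exact: ltW.
  by apply=> //; exact: measurable_funB.
have [A0 HA] := H (e ^+ 2) (exprn_gt0 _ e0); exists A0 => A /HA h.
by apply/L2norm_lt => //; exact: measurable_funB.
Qed.

Lemma haar_sum_exists sigma g : signs sigma -> sqint g ->
  haar_sum sigma g (Tsigma sigma g).
Proof.
move=> sg qg; apply: xgetPex.
have [|F mF H] := @haar_series_converges (fun I => sigma I * inner g (haar I)) (2 * nsq g).
  move=> A uA; apply: le_trans (haar_bessel qg uA); apply: ler_sum => I _.
  rewrite exprMn innerC; have -> : sigma I ^+ 2 = 1.
    by case: (sg I) => ->; rewrite ?sqrrN expr1n.
  by rewrite mul1r.
exists F; apply/haar_sumP; split=> // e /H[A uA HA].
exists [fset I in A]%fset => B /fsubsetP AB; apply: HA; first exact: fset_uniq.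
by move=> I IA; apply: AB; rewrite !inE.
Qed.

Lemma haar_sum_sqint sigma g F : haar_sum sigma g F -> sqint F.
Proof.
move=> /haar_sumP[mF /(_ _ ltr01)[A /(_ A (fsubset_refl _))[q _]]].
rewrite (_ : F = fun x => haar_psum sigma g A x - (haar_psum sigma g A x - F x)).
  by apply: sqintB => //; exact: sqint_haar_poly.
by apply/funext => x; ring.
Qed.

(** Recovers finite sums from bounds on the full operators: outside [A] the two series
cancel. *)
Lemma haar_sum_flip sigma1 sigma2 c g F1 F2 A : uniq A ->
  haar_sum sigma1 g F1 -> haar_sum sigma2 g F2 ->
  (forall I, I \in A -> (sigma1 I - sigma2 I) * inner g (haar I) = c I) ->
  (forall I, I \notin A -> sigma1 I = sigma2 I) ->
  {ae mu, forall x, F1 x - F2 x = haar_poly c A x}.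
Proof.
move=> uA HF1 HF2 sA snA; have qF1 := haar_sum_sqint HF1; have qF2 := haar_sum_sqint HF2.
pose D x := haar_poly c A x - (F1 x - F2 x).
have qD : sqint D by apply: sqintB; [exact: sqint_haar_poly | exact: sqintB].
have nD : nsq D <= 0.
  apply/ler_addgt0Pr => e e0; rewrite add0r.
  have e4 : 0 < e / 4 by rewrite divr_gt0.
  have [_ /(_ _ e4)[A1 H1]] := (haar_sumP _ _ _).1 HF1.
  have [_ /(_ _ e4)[A2 H2]] := (haar_sumP _ _ _).1 HF2.
  pose B := (A1 `|` (A2 `|` [fset I in A]))%fset.
  have [q1 n1] := H1 B (fsubsetUl _ _).
  have [q2 n2] := H2 B (fsubset_trans (fsubsetUl _ _) (fsubsetUr _ _)).
  have PE x : haar_psum sigma1 g B x - haar_psum sigma2 g B x = haar_poly c A x.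
    rewrite /haar_psum -sumrB (bigID (mem A)) /= [X in _ + X]big1 ?addr0; last first.
      by move=> I /snA ->; rewrite subrr.
    rewrite -big_filter (@perm_big _ _ _ _ _ A).
      rewrite /haar_poly big_seq [RHS]big_seq; apply: eq_bigr => I /sA <-; ring.
    apply: uniq_perm => //; first by apply: filter_uniq; exact: fset_uniq.
    move=> I; rewrite mem_filter; case: (boolP (I \in A)) => IA //=.
    by rewrite !inE IA !orbT.
  have -> : D = fun x => (haar_psum sigma1 g B x - F1 x) +
      (-1) * (haar_psum sigma2 g B x - F2 x).
    by apply/funext => x; rewrite /D -PE; ring.
  apply: (le_trans (nsqD_le q1 (sqintZ _ q2))); rewrite nsqZ//; lra.
have : ae_eq mu setT (fun x => (D x ^+ 2)%:E) (cst 0%E).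
  apply/ae_eq_integral_abs => //.
    by apply/measurable_EFinP; apply: measurable_funX; case: qD.
  under eq_integral do rewrite gee0_abs ?lee_fin ?sqr_ge0//.
  by rewrite nsqE//; congr EFin; apply/eqP; rewrite eq_le nD nsq_ge0.
apply: ae_mono => x /(_ Logic.I) [] /eqP; rewrite expf_eq0 /= subr_eq0 => /eqP.
by move=> ->.
Qed.

End HaarSeries.

Section HaarMultipliers.
Context {R : realType}.
Local Notation mu := (@lebesgue_measure R).
Variables v w : R -> R.
Hypotheses (hv : weight v) (hw : weight w).
Local Notation r := (root w).
Local Notation s := (root v).
Implicit Types (f g F : R -> R) (I : dyadic) (A : seq dyadic) (sigma : dyadic -> R).

Let qr : locally_sqint r := weight_locally_sqint hw.
Let qs : locally_sqint s := weight_locally_sqint hv.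
Let mr : measurable_fun setT r := measurable_root (weight_measurable hw).
Let ms : measurable_fun setT s := measurable_root (weight_measurable hv).

Lemma sqint_root_bcs f : bounded_compactly_supported f ->
  sqint (fun x => r x * f x).
Proof.
move=> [mf [M fM] [K cK fK]].
split; first exact: measurable_funM.
have mK : measurable K by exact: compact_measurable.
have [[mw _ wK] _] := hw.
have wK' := wK K (@subsetT _ _) cK.
have mwK : measurable_fun K (fun x => `|w x|%:E).
  by apply/measurable_EFinP; apply: measurable_funTS; exact: measurableT_comp.
apply: (@le_lt_trans _ _ ((M ^+ 2)%:E * \int[mu]_(x in K) `|w x|%:E)%E); last first.
  by rewrite lte_mul_pinfty ?lee_fin ?sqr_ge0.
rewrite -ge0_integralZl_EFin ?sqr_ge0// [leRHS]integral_mkcond.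
apply: ge0_le_integral.
- by [].
- by move=> x _; rewrite lee_fin sqr_ge0.
- by apply/measurable_EFinP; apply: measurable_funX; exact: measurable_funM.
- apply: (iffLR (measurable_restrictT _ mK)).
  exact: measurable_funeM.
- move=> x _; rewrite patchE.
  have [h|h] := pselect (K x); last first.
    by rewrite memNset// fK// mulr0 expr0n /=; exact: lexx.
  rewrite mem_set// -EFinM lee_fin exprMn mulrC ler_pM ?sqr_ge0 ?root_sqr_le//.
  rewrite -(real_normK (num_real (f x))) lerXn2r ?nnegrE//.
  exact: le_trans (fM x).
Qed.

Lemma multiplier_sumE sigma f (A : seq dyadic) x : multiplier_sum r s sigma f A x =
  s x * haar_poly (fun I => sigma I * inner (fun y => r y * f y) (haar I)) A x.
Proof.
rewrite mulr_sumr; apply: eq_bigr => I _.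
by rewrite inner_haar /weighted_haar; ring.
Qed.

(** Where [s] is bounded, multiplication by [s] is continuous in [L2] and the bound on
finite sums passes to the limit; such sets exhaust the line. *)
Lemma multipliers_bounded_Tsigma : multipliers_bounded r s ->
  exists2 C : R, 0 < C & forall sigma f, signs sigma -> bounded_compactly_supported f ->
    (\int[mu]_x ((s x * Tsigma sigma (fun y => r y * f y) x) ^+ 2)%:E
      <= (C * nsq f)%:E)%E.
Proof.
move=> [C C0 H]; exists (2 * C) => [|sigma f sg bf]; first by rewrite mulr_gt0.
have qf := bcs_sqint bf; have hF := haar_sum_exists sg (sqint_root_bcs bf).
set F := Tsigma _ _ in hF *; have qF := haar_sum_sqint hF; have mF := sqint_measurable qF.
apply: (integral_sqr_exhaust (E := truncation_set s)).
- exact: measurable_funM.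
- by move=> n; exact: measurable_truncation_set.
- exact: truncation_set_mono.
- exact: truncation_set_cover.
move=> n; set E := truncation_set s n.
have mE : measurable E by exact: measurable_truncation_set.
pose b x := s x * \1_E x.
have mb : measurable_fun setT b by exact: measurable_funM.
have bn x : `|b x| <= n%:R.
  rewrite /b indicE; have [h|h] := pselect (E x); last by rewrite memNset// mulr0 normr0.
  by rewrite mem_set// mulr1; case: h.
have qbF : sqint (fun x => b x * F x) by exact: (sqint_mul_bounded mb bn).
have -> : (fun x => ((s x * F x * \1_E x) ^+ 2)%:E) = fun x => ((b x * F x) ^+ 2)%:E.
  by apply/funext => x; rewrite /b mulrAC.
rewrite nsqE// lee_fin; apply/ler_addgt0Pr => e e0.
pose e' : R := e / (2 * n.+1%:R ^+ 2).
have n0 : 0 < n.+1%:R ^+ 2 :> R by rewrite exprn_gt0.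
have e'0 : 0 < e' by rewrite divr_gt0// mulr_gt0.
have [_ /(_ _ e'0)[A /(_ A (fsubset_refl _))[qP nP]]] := (haar_sumP _ _ _).1 hF.
set P := haar_psum _ _ _ in qP nP.
have qbP : sqint (fun x => b x * (P x - F x)) by exact: (sqint_mul_bounded mb bn).
have Q := H sigma f A sg qf (fset_uniq A).
set q := multiplier_sum _ _ _ _ _ in Q.
have qq : sqint q by exact: sqint_multiplier_sum.
have qE x : q x = s x * P x by exact: multiplier_sumE.
have qqE : sqint (fun x => q x * \1_E x) by exact: sqint_indic.
rewrite (_ : (fun x => b x * F x) =
    fun x => q x * \1_E x + (-1) * (b x * (P x - F x))); last first.
  by apply/funext => x; rewrite qE /b; ring.
apply: (le_trans (nsqD_le qqE (sqintZ _ qbP))); rewrite nsqZ//.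
have h1 : nsq (fun x => q x * \1_E x) <= nsq q.
  apply: le_nsq => // x; rewrite normrM ler_piMr// indicE.
  by case: (_ \in _); rewrite ?normr1 ?normr0.
have h2 : nsq (fun x => b x * (P x - F x)) <= n.+1%:R ^+ 2 * e'.
  apply: (@le_trans _ _ (nsq (fun x => n.+1%:R * (P x - F x)))).
    apply: le_nsq => //; first exact: sqintZ.
    move=> x; rewrite normrM [leRHS]normrM ler_wpM2r// [leRHS]ger0_norm//.
    by apply: (le_trans (bn x)); rewrite ler_nat.
  by rewrite nsqZ// ler_wpM2l ?sqr_ge0// ltW.
have h3 : n.+1%:R ^+ 2 * e' = e / 2.
  by move: n0; rewrite /e'; move: (n.+1%:R ^+ 2) => k k0; field; rewrite gt_eqF.
lra.
Qed.

(** Cauchy-Schwarz term by term. The constant depends on [A], which is harmless when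
[f] is approximated for a fixed [A]. *)
Lemma multiplier_sum_crude sigma A : signs sigma ->
  exists2 K : R, 0 <= K & forall f, sqint f ->
    nsq (multiplier_sum r s sigma f A) <= K * nsq f.
Proof.
move=> sg; elim: A => [|I A [K K0 H]].
  exists 0 => // f qf; rewrite mul0r /multiplier_sum.
  by under eq_fun do rewrite big_nil; rewrite /nsq inner0l.
exists (2 * (nsq (weighted_haar r I) * nsq (weighted_haar s I)) + 2 * K).
  by rewrite addr_ge0// mulr_ge0// mulr_ge0// nsq_ge0.
move=> f qf; have qwr := sqint_weighted_haar I qr; have qws := sqint_weighted_haar I qs.
rewrite (_ : multiplier_sum _ _ _ _ _ = fun x =>
  sigma I * inner (weighted_haar r I) f * weighted_haar s I x +
  multiplier_sum r s sigma f A x); last by apply/funext => x; rewrite /multiplier_sum big_cons.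
apply: (le_trans (nsqD_le (sqintZ _ qws) (sqint_multiplier_sum r sigma f A qs))).
rewrite nsqZ// exprMn (_ : sigma I ^+ 2 = 1) ?mul1r; last first.
  by case: (sg I) => ->; rewrite ?sqrrN expr1n.
have h1 := ler_wpM2r (nsq_ge0 (weighted_haar s I)) (inner_sqr_le qwr qf).
have := H f qf; lra.
Qed.

(** Reversing the signs on a finite set changes the operator by twice the finite sum,
which bounds this sum on bounded compactly supported functions. These are dense, and a
fixed finite sum is continuous. *)
Lemma Tsigma_multipliers_bounded (C : R) : 0 < C ->
  (forall sigma f, signs sigma -> bounded_compactly_supported f ->
    (\int[mu]_x ((s x * Tsigma sigma (fun y => r y * f y) x) ^+ 2)%:E
      <= (C * nsq f)%:E)%E) ->
  multipliers_bounded r s.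
Proof.
move=> C0 H.
have Hb sigma f A : signs sigma -> bounded_compactly_supported f -> uniq A ->
    nsq (multiplier_sum r s sigma f A) <= C * nsq f.
  move=> sg bf uA; have qrf := sqint_root_bcs bf; have qf := bcs_sqint bf.
  pose s1 I := if I \in A then sigma I else 1.
  pose s2 I := if I \in A then - sigma I else 1.
  have sg1 : signs s1 by move=> I; rewrite /s1; case: ifP => _; [exact: sg | left].
  have sg2 : signs s2.
    move=> I; rewrite /s2; case: ifP => _; last by left.
    by case: (sg I) => ->; [right | left; rewrite opprK].
  have H1 := haar_sum_exists sg1 qrf; have H2 := haar_sum_exists sg2 qrf.
  have T1 := H s1 f sg1 bf; have T2 := H s2 f sg2 bf.
  set F1 := Tsigma s1 _ in H1 T1; set F2 := Tsigma s2 _ in H2 T2.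
  have mF1 := sqint_measurable (haar_sum_sqint H1).
  have mF2 := sqint_measurable (haar_sum_sqint H2).
  pose c I := 2 * (sigma I * inner (fun y => r y * f y) (haar I)).
  have ae : {ae mu, forall x, F1 x - F2 x = haar_poly c A x}.
    apply: (haar_sum_flip uA H1 H2) => I IA; rewrite /s1 /s2.
      by rewrite IA /c; ring.
    by rewrite (negPf IA).
  have [q1 n1] := sqr_le_sqint (measurable_funM ms mF1) T1.
  have [q2 n2] := sqr_le_sqint (measurable_funM ms mF2) T2.
  set Q := multiplier_sum r s sigma f A.
  have qQ : sqint Q by exact: sqint_multiplier_sum.
  have QE x : s x * haar_poly c A x = 2 * Q x.
    rewrite /Q multiplier_sumE /haar_poly !mulr_sumr.
    by apply: eq_bigr => I _; rewrite /c; ring.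
  have q2Q : sqint (fun x => 2 * Q x) by exact: sqintZ.
  have qd : sqint (fun x => s x * F1 x + (-1) * (s x * F2 x)).
    by apply: sqintD => //; exact: sqintZ.
  have E : nsq (fun x => 2 * Q x) = nsq (fun x => s x * F1 x + (-1) * (s x * F2 x)).
    apply: EFin_inj; rewrite -!nsqE//; apply: ge0_ae_eq_integral => //.
    - by apply/measurable_EFinP; apply: measurable_funX; case: q2Q.
    - by apply/measurable_EFinP; apply: measurable_funX; case: qd.
    - by move=> x _; rewrite lee_fin sqr_ge0.
    - by move=> x _; rewrite lee_fin sqr_ge0.
    - by apply: ae_mono ae => x xE _; rewrite -QE -xE; congr (_ ^+ 2)%:E; ring.
  have := nsqD_le q1 (sqintZ (-1) q2); rewrite -E !nsqZ//.
  lra.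
exists (2 * C) => [|sigma f A sg qf uA]; first by rewrite mulr_gt0.
have [K K0 HK] := multiplier_sum_crude A sg.
apply/ler_addgt0Pr => e e0.
have d0 : 0 < e / (2 * K + 1) by rewrite divr_gt0// ltr_wpDl// mulr_ge0.
have [h [bh hf hd]] := bcs_dense qf d0; have qh := bcs_sqint bh.
have qfh : sqint (fun x => f x - h x) by exact: sqintB.
rewrite (_ : multiplier_sum _ _ _ _ _ = fun x => multiplier_sum r s sigma h A x +
    multiplier_sum r s sigma (fun x => f x - h x) A x); last first.
  apply/funext => x; rewrite -big_split /=; apply: eq_bigr => I _.
  rewrite !(innerC (weighted_haar r I)) innerBl//; last exact: sqint_weighted_haar.
  by ring.
apply: (le_trans (nsqD_le (sqint_multiplier_sum _ _ _ _ qs) (sqint_multiplier_sum _ _ _ _ qs))).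
have h1 := Hb sigma h A sg bh uA; have h2 := HK _ qfh.
have h3 : C * nsq h <= C * nsq f by rewrite ler_pM2l.
have h4 : 2 * (K * nsq (fun x => f x - h x)) <= e.
  apply: (@le_trans _ _ ((2 * K) * (e / (2 * K + 1)))).
    by rewrite mulrA ler_wpM2l// mulr_ge0.
  rewrite mulrA ler_pdivrMr; last by rewrite ltr_wpDl// mulr_ge0.
  by rewrite mulrDr mulr1 (mulrC e) lerDl ltW.
lra.
Qed.

End HaarMultipliers.

(** * The two-weight theorem *)

Section Conditions.
Context {R : realType}.
Local Notation mu := (@lebesgue_measure R).
Implicit Types (v w f : R -> R) (I J : dyadic).

Lemma avg_ge0 w J : weight w -> 0 <= avg w J.
Proof. by move=> hw; rewrite avgE// divr_ge0 ?nsq_ge0// ltW// len_gt0. Qed.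

Lemma muckenhouptP v w : weight v -> weight w ->
  muckenhoupt (root w) (root v) <-> exists C : R, forall J, avg v J * avg w J <= C.
Proof.
move=> hv hw; have E J : avg v J * avg w J =
    mass (root w) J * mass (root v) J / len J ^+ 2.
  by rewrite !avgE//; field; exact: len_neq0.
have l0 J : 0 < len J ^+ 2 :> R by rewrite exprn_gt0// len_gt0.
by split=> -[C H]; exists C => J; [rewrite E ler_pdivrMr | rewrite -ler_pdivrMr// -E].
Qed.

Definition testing_condition v w (C : R) : Prop := forall J : dyadic,
  (((len J)^-1)%:E *
    (\esum_(I in [set I : dyadic | @dset R I `<=` dset J])
      (`|avg w (left_half I) - avg w (right_half I)| ^+ 2
       * avg v I * len I)%:E)
   <= (C * avg w J)%:E)%E.

Lemma testingP v w : weight v -> weight w ->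
  testing (root w) (root v) <-> exists C : R, testing_condition v w C.
Proof.
move=> hv hw; pose t I := `|avg w (left_half I) - avg w (right_half I)| ^+ 2
       * avg v I * len I.
have tE I : t I = 4 * testing_mass (root w) (root v) I.
  rewrite /t real_normK ?num_real// drop_avg// avgE// /testing_mass.
  by field; exact: len_neq0.
have l0 J := len_gt0 J (R := R).
have E (C : R) J : ((((len J)^-1)%:E * (\esum_(I in [set I : dyadic | @dset R I `<=` dset J])
    (t I)%:E) <= (C * avg w J)%:E) = (\esum_(I in [set I : dyadic | @dset R I `<=` dset J])
    (t I)%:E <= (C * mass (root w) J)%:E))%E.
  rewrite lee_pdivrMl// -EFinM; congr (_ <= _%:E)%E.
  by rewrite weight_mass// mulrCA.
split=> [[C H]|[C H]].
  exists (4 * C) => J; rewrite E; apply: esum_le => A uA AJ; rewrite lee_fin.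
  by under eq_bigr do rewrite tE; rewrite -mulr_sumr -mulrA ler_pM2l// H.
exists (4^-1 * C) => J A uA AJ; have := H J; rewrite E.
move/(le_trans (le_sum_esum t uA AJ)); rewrite lee_fin.
under eq_bigr do rewrite tE.
by rewrite -mulr_sumr mulrC -ler_pdivlMr// => h; rewrite -mulrA mulrC.
Qed.

Lemma testing_condition_mono v w (C C' : R) : weight w -> C <= C' ->
  testing_condition v w C -> testing_condition v w C'.
Proof.
move=> hw CC H J; apply: (le_trans (H J)).
by rewrite lee_fin ler_wpM2r// avg_ge0.
Qed.

Lemma measurable_fun_inv f : measurable_fun setT f ->
  measurable_fun setT (fun x => (f x)^-1).
Proof.
move=> mf; apply: (measurableT_comp _ mf).
have -> : [set: R] = [set~ 0] `|` [set 0] by rewrite setUC setUv.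
have m0 : measurable [set (0 : R)] by exact: measurable_set1.
apply: (iffRL (measurable_funU _ (measurableC m0) m0)).
split; last exact: measurable_fun_set1.
apply: open_continuous_measurable_fun.
  by apply: closed_openC; exact: closed_eq.
by move=> x; rewrite inE => /eqP x0; exact: inv_continuous.
Qed.

Lemma L2P f : L2 f <-> sqint f.
Proof.
have i0 : (0 <= \int[mu]_x ((EFin \o f) x * (EFin \o f) x))%E.
  by apply: integral_ge0 => x _; rewrite lee_fin -expr2 sqr_ge0.
by split=> -[mf h]; split=> //; move: h; rewrite L2normE poweR_half_lty//;
  congr (_ < _)%E; apply: eq_integral => x _; rewrite /= expr2 EFinM.
Qed.

Lemma integral_EFin_sqr f : sqint f ->
  (\int[mu]_x ((EFin \o f) x * (EFin \o f) x) = (nsq f)%:E)%E.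
Proof.
by move=> qf; rewrite -nsqE//; apply: eq_integral => x _; rewrite /= expr2 EFinM.
Qed.

Lemma mule_self_ge0 (x : \bar R) : (0 <= x * x)%E.
Proof. by rewrite -expe2 sqre_ge0. Qed.

Section TwoWeights.
Variables v w : R -> R.
Hypotheses (hv : weight v) (hw : weight w).

Definition T0_bounded : Prop := exists2 C : R, 0 < C & forall f, sqint f ->
  (\int[mu]_x (rootT0 v w f x * rootT0 v w f x) <= C%:E * (nsq f)%:E)%E.

Lemma T0_boundedP : T0_bounded <-> diagonal_bounded (root w) (root v).
Proof.
split=> [[C C0 H]|H]; first exact: T0_diagonal_bounded H.
exact: diagonal_bounded_T0.
Qed.

Lemma opnorm_T0_unweighted :
  (opnorm L2 L2norm L2norm
      (fun f x => (Num.sqrt (v x))%:E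
                  * T0 v w (fun y => Num.sqrt (w y) * f y)%R x)%E < +oo)%E <->
  T0_bounded.
Proof.
rewrite (@opnorm_lty _ _ _ _ _ (fun f => (nsq f)%:E)
  (fun f => \int[mu]_x (rootT0 v w f x * rootT0 v w f x))%E).
- by split=> -[C C0 H]; exists C => // f /L2P qf; exact: H.
- by move=> f /L2P qf; rewrite L2normE integral_EFin_sqr// lee_fin nsq_ge0.
- move=> f _; rewrite L2normE; split=> //.
  by apply: integral_ge0 => x _; exact: mule_self_ge0.
Qed.

Lemma avg_ae_eq f g : measurable_fun setT f -> measurable_fun setT g ->
  {ae mu, forall x, f x = g x} -> avg f =1 avg g.
Proof.
move=> mf mg fg I; congr (_ * fine _); apply: ae_eq_integral.
- exact: measurable_dset.
- by apply/measurable_EFinP; exact: measurable_funTS.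
- by apply/measurable_EFinP; exact: measurable_funTS.
- by apply: ae_mono fg => x /= -> _.
Qed.

Lemma T0_ae_eq f g : measurable_fun setT f -> measurable_fun setT g ->
  {ae mu, forall x, f x = g x} -> T0 v w f = T0 v w g.
Proof.
move=> mf mg fg; have E x I : T0_term v w f x I = T0_term v w g x I.
  by rewrite /T0_term (avg_ae_eq mf mg fg).
apply/funext => x; rewrite /T0.
by congr (_ - _)%E; apply: eq_esum => I _; rewrite E.
Qed.

Let mr : measurable_fun setT (root w) := measurable_root (weight_measurable hw).
Let ms : measurable_fun setT (root v) := measurable_root (weight_measurable hv).

(** The isometry of [L2(1/w)] onto [L2], inverse almost everywhere to multiplication by
the root of [w]. *)
Definition unweight f : R -> R := fun x => f x * root (fun y => (w y)^-1) x.

Lemma measurable_inv_root : measurable_fun setT (root (fun y => (w y)^-1)).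
Proof.
by apply: measurable_root; exact: (measurable_fun_inv (weight_measurable hw)).
Qed.

Lemma unweightK f : {ae mu, forall x, root w x * unweight f x = f x}.
Proof.
case: hw => _; apply: ae_mono => x w0.
rewrite /unweight /root sqrtrV ?ltW// mulrCA mulfV ?mulr1// gt_eqF//.
by rewrite sqrtr_gt0.
Qed.

Lemma integral_unweight f : measurable_fun setT f ->
  (\int[mu]_x ((EFin \o f) x * (EFin \o f) x * ((w x)^-1)%:E) =
   \int[mu]_x (unweight f x ^+ 2)%:E)%E.
Proof.
move=> mf; apply: ae_eq_integral => //.
- apply: emeasurable_funM; first by apply: emeasurable_funM; exact/measurable_EFinP.
  by apply/measurable_EFinP; exact: (measurable_fun_inv (weight_measurable hw)).
- apply/measurable_EFinP; apply: measurable_funX; apply: measurable_funM => //.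
  exact: measurable_inv_root.
- case: hw => _; apply: ae_mono => x w0 _ /=.
  rewrite -!EFinM /unweight exprMn /root sqr_sqrtr ?expr2//.
  by rewrite invr_ge0 ltW.
Qed.

Lemma integral_T0_weight f : (\int[mu]_x (T0 v w f x * T0 v w f x * (v x)%:E) =
  \int[mu]_x (((root v x)%:E * T0 v w f x) * ((root v x)%:E * T0 v w f x)))%E.
Proof.
have mT := @measurable_T0 R v w f.
apply: ae_eq_integral => //.
- apply: emeasurable_funM; first exact: emeasurable_funM.
  by apply/measurable_EFinP; exact: weight_measurable.
- by apply: emeasurable_funM; apply: emeasurable_funM => //; exact/measurable_EFinP.
- case: hv => _; apply: ae_mono => x v0 _ /=.
  by rewrite muleACA -EFinM -expr2 /root sqr_sqrtr ?ltW// muleC.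
Qed.

Lemma opnorm_T0_weighted :
  (opnorm (wL2 (fun x => (w x)^-1)%R) (wL2norm (fun x => (w x)^-1)%R)
            (wL2norm v) (T0 v w) < +oo)%E <-> T0_bounded.
Proof.
have i0 f : (0 <= \int[mu]_x (unweight f x ^+ 2)%:E)%E.
  by apply: integral_ge0 => x _; rewrite lee_fin sqr_ge0.
have mfl f : measurable_fun setT f -> measurable_fun setT (unweight f).
  by move=> mf; apply: measurable_funM => //; exact: measurable_inv_root.
have wL2P f : wL2 (fun x => (w x)^-1)%R f <-> measurable_fun setT f /\ sqint (unweight f).
  split=> -[mf]; rewrite ?wL2normE ?integral_unweight// ?poweR_half_lty//.
    by move=> h; split=> //; split=> //; exact: mfl.
  by move=> [_ h]; split=> //; rewrite wL2normE integral_unweight// poweR_half_lty.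
have T0E f : measurable_fun setT f -> T0 v w (fun y => root w y * unweight f y) = T0 v w f.
  move=> mf; apply: T0_ae_eq => //; last exact: unweightK.
  by apply: measurable_funM => //; exact: mfl.
rewrite (@opnorm_lty _ _ _ _ _ (fun f => \int[mu]_x (unweight f x ^+ 2)%:E)%E
  (fun f => \int[mu]_x (((root v x)%:E * T0 v w f x) * ((root v x)%:E * T0 v w f x)))%E).
- split=> -[C C0 H]; exists C => // f.
    move=> qf; pose g x := root w x * f x.
    have mf := sqint_measurable qf; have mg : measurable_fun setT g by exact: measurable_funM.
    have E : (\int[mu]_x (unweight g x ^+ 2)%:E = (nsq f)%:E)%E.
      rewrite -nsqE//; apply: ae_eq_integral => //.
      + by apply/measurable_EFinP; apply: measurable_funX; exact: mfl.
      + by apply/measurable_EFinP; exact: measurable_funX.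
      + case: hw => _; apply: ae_mono => x w0 _.
        rewrite /unweight /g /root sqrtrV ?ltW// mulrAC mulfV ?mul1r// gt_eqF//.
        by rewrite sqrtr_gt0.
    have qg : wL2 (fun x => (w x)^-1)%R g.
      by apply/wL2P; split=> //; split; [exact: mfl | rewrite E ltry].
    by have := H g qg; rewrite E.
  move=> /wL2P[mf qf]; have := H _ qf.
  by rewrite /rootT0 T0E// -nsqE.
- by move=> f /wL2P[mf qf]; rewrite wL2normE integral_unweight.
- move=> f _; rewrite wL2normE integral_T0_weight; split=> //.
  by apply: integral_ge0 => x _; exact: mule_self_ge0.
Qed.

Lemma uniformly_bounded_Tsigma :
  (ereal_sup [set opnorm bounded_compactly_supported L2norm L2norm
                     (MTM v w sigma) | sigma in @signs R] < +oo)%E <->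
  haar_bounded (root w) (root v).
Proof.
have qr := weight_locally_sqint hw; have qs := weight_locally_sqint hv.
rewrite (@sup_opnorm_lty _ _ _ _ _ _ _ (fun f => (nsq f)%:E)
  (fun sigma f => \int[mu]_x ((root v x *
    Tsigma sigma (fun y => root w y * f y) x) ^+ 2)%:E)%E).
- split=> [[C C0 H]|/(haar_multipliers_bounded qr qs)].
    apply: (multipliers_haar_bounded qr qs).
    by apply: (Tsigma_multipliers_bounded hv hw C0) => sigma f sg bf; rewrite EFinM; exact: H.
  move=> /(multipliers_bounded_Tsigma hv hw)[C C0 H].
  by exists C.
- move=> f /bcs_sqint qf.
  by rewrite L2normE integral_EFin_sqr// lee_fin nsq_ge0.
- move=> sigma f _ _; rewrite L2normE; split.
    by congr (_ `^ _)%E; apply: eq_integral => x _; rewrite /MTM -EFinM -expr2.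
  by apply: integral_ge0 => x _; rewrite lee_fin sqr_ge0.
Qed.

End TwoWeights.

End Conditions.

Theorem theorem0p2 (R : realType) (v w : R -> R) (hv : weight v)
    (hw : weight w) :
  ((ereal_sup [set opnorm bounded_compactly_supported L2norm L2norm
                     (MTM v w sigma) | sigma in @signs R] < +oo)%E
   <->
   exists C : R,
     [/\ forall J : dyadic, avg v J * avg w J <= C,
         forall J : dyadic,
           (((len J)^-1)%:E *
             (\esum_(I in [set I : dyadic | @dset R I `<=` dset J])
               (`|avg v (left_half I) - avg v (right_half I)| ^+ 2
                * avg w I * len I)%:E)
            <= (C * avg v J)%:E)%E,
         forall J : dyadic,
           (((len J)^-1)%:E *
             (\esum_(I in [set I : dyadic | @dset R I `<=` dset J])
               (`|avg w (left_half I) - avg w (right_half I)| ^+ 2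
                * avg v I * len I)%:E)
            <= (C * avg w J)%:E)%E
       & (opnorm (wL2 (fun x => (w x)^-1)%R) (wL2norm (fun x => (w x)^-1)%R)
            (wL2norm v) (T0 v w) < +oo)%E])
  /\
  ((opnorm (wL2 (fun x => (w x)^-1)%R) (wL2norm (fun x => (w x)^-1)%R)
      (wL2norm v) (T0 v w) < +oo)%E
   <->
   (opnorm L2 L2norm L2norm
      (fun f x => (Num.sqrt (v x))%:E
                  * T0 v w (fun y => Num.sqrt (w y) * f y)%R x)%E < +oo)%E).
Proof.
split; last by rewrite opnorm_T0_weighted// opnorm_T0_unweighted//.
rewrite uniformly_bounded_Tsigma// haar_bounded_iff; first last.
- by move=> I; exact: weight_mass_gt0.
- by move=> I; exact: weight_mass_gt0.
- exact: weight_locally_sqint.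
- exact: weight_locally_sqint.
split=> [[A2 Tw Tv D]|[C [A2 Tv Tw D]]].
  have /(muckenhouptP hv hw)[C1 H1] := A2.
  have /(testingP hw hv)[C2 H2] := Tv; have /(testingP hv hw)[C3 H3] := Tw.
  exists (Num.max C1 (Num.max C2 C3)); split.
  - by move=> J; rewrite le_max H1.
  - by apply: (testing_condition_mono hv _ H2); rewrite !le_max lexx orbT.
  - by apply: (testing_condition_mono hw _ H3); rewrite !le_max lexx !orbT.
  - by apply/opnorm_T0_weighted => //; apply/T0_boundedP.
split.
- by apply/muckenhouptP => //; exists C.
- by apply/testingP => //; exists C.
- by apply/testingP => //; exists C.
- by apply/T0_boundedP => //; apply/opnorm_T0_weighted.
Qed.
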